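(* Let $n\geq 2$, let $p\in\mathbb{R}^n$, and let $\Phi:\mathcal{K}^n\to\mathcal{K}^n$ be a continuous, translation invariant Minkowski valuation satisfying (VC). Then either $\dim(\Phi(\{p\}))=0$ or $\dim(\Phi(\{p\}))=n-1$.
   Context: $\mathcal{K}^n$ is the space of convex bodies in $\mathbb{R}^n$ with the Hausdorff metric and Minkowski addition. A Minkowski valuation is a map $\Phi:\mathcal{K}^n\to\mathcal{K}^n$ with $\Phi(K)+\Phi(L)=\Phi(K\cup L)+\Phi(K\cap L)$ whenever $K,L,K\cup L\in\mathcal{K}^n$. Translation invariant: $\Phi(K+t)=\Phi(K)$. $\dim$ is the dimension of the affine hull. (VC): there are $c,C>0$ with $cV_n(K)\le V_n(\Phi(K))\le CV_n(K)$ for all $K$, $V_n$ the volume. *)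

(* Defs.v *)
From HB Require Import structures.
From mathcomp Require Import all_boot all_order all_algebra.
From mathcomp Require Import all_classical all_reals all_analysis.
Set Implicit Arguments. Unset Strict Implicit. Unset Printing Implicit Defensive.
Import Order.TTheory GRing.Theory Num.Theory.
Import numFieldNormedType.Exports.
Local Open Scope classical_set_scope.
Local Open Scope ring_scope.

Section ConvexGeometry.
Variables (R : realType) (n : nat).
Notation V := 'rV[R]_n.

Definition edist (x y : V) : R := Num.sqrt (\sum_i (x 0 i - y 0 i) ^+ 2).

Definition convex_set (A : set V) : Prop :=
  forall x y t, A x -> A y -> 0 <= t -> t <= 1 -> A ((1 - t) *: x + t *: y).

Definition convex_body (A : set V) : Prop :=
  A !=set0 /\ compact A /\ convex_set A.

Definition msum (A B : set V) : set V := [set x + y | x in A & y in B].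

Definition translate (A : set V) (t : V) : set V := [set x + t | x in A].

Definition hclose (e : R) (A B : set V) : Prop :=
  (forall x, A x -> exists2 y, B y & edist x y <= e) /\
  (forall y, B y -> exists2 x, A x & edist x y <= e).

Definition hausdorff (A B : set V) : R := inf [set e | 0 <= e /\ hclose e A B].

Definition box (a b : V) : set V := [set x | forall i, a 0 i <= x 0 i <= b 0 i].
Definition boxvol (a b : V) : R := \prod_i Num.max (b 0 i - a 0 i) 0.
Definition volume (A : set V) : \bar R :=
  ereal_inf [set r : \bar R | exists a b : nat -> V,
     A `<=` \bigcup_k box (a k) (b k) /\
     r = (\sum_(0 <= k <oo) (boxvol (a k) (b k))%:E)%E].

(* dimension of the affine hull of A equals d:
   for some base point x0 in A, the linear span of A - x0 has dimension d,
   i.e. the maximal number of linearly independent vectors x - x0 (x in A) is d *)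
Definition rows_in (A : set V) (x0 : V) m (M : 'M[R]_(m, n)) : Prop :=
  forall i, A (row i M + x0).
Definition has_dim (A : set V) (d : nat) : Prop :=
  exists2 x0, A x0 &
    (exists2 M : 'M[R]_(d, n), rows_in A x0 M & \rank M = d) /\
    (forall m (M : 'M[R]_(m, n)), rows_in A x0 M -> (\rank M <= d)%N).

(* Minkowski valuations on convex bodies; Phi is a map on sets, required to
   send convex bodies to convex bodies (its values elsewhere are irrelevant). *)
Definition body_map (Phi : set V -> set V) : Prop :=
  forall K, convex_body K -> convex_body (Phi K).

Definition minkowski_valuation (Phi : set V -> set V) : Prop :=
  body_map Phi /\
  forall K L, convex_body K -> convex_body L -> convex_body (K `|` L) ->
    msum (Phi K) (Phi L) = msum (Phi (K `|` L)) (Phi (K `&` L)).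

Definition translation_invariant (Phi : set V -> set V) : Prop :=
  forall K t, convex_body K -> Phi (translate K t) = Phi K.

Definition hcontinuous (Phi : set V -> set V) : Prop :=
  forall K, convex_body K -> forall e : R, 0 < e ->
    exists2 d : R, 0 < d & forall L, convex_body L ->
      hausdorff K L < d -> hausdorff (Phi K) (Phi L) < e.

Definition VC (Phi : set V -> set V) : Prop :=
  exists c C : R, [/\ 0 < c, 0 < C &
    forall K, convex_body K ->
      (c%:E * volume K <= volume (Phi K) <= C%:E * volume K)%E].

End ConvexGeometry.

(* Main.v *)
(* For a basis w of R^n put P(l) = sum_i l_i [0, w_i]. The valuation property, translation
   invariance and continuity make h(Phi (P l), u) affine in each l_i, so it equals
   sum_I (prod_(i in I) l_i) f_I(u) over the subsets I of the index set. Each f_I is the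
   support function of a body L_I, the limit of Phi (N P_I) / N^|I|, and L_set0 = Phi {p}.
   Hence Phi (P l) contains a translate of the parallelepiped spanned by (up to a factor)
   prod_(j in I_i) l_j v_i whenever v_i is a difference of points of L_(I_i). Comparing
   volumes with (VC) for all l forces any family (I_i, v_i) with v a basis to be balanced: every index lies in
   exactly one I_i. Also by (VC) the differences span R^n.
   Let j = dim Phi {p}. A basis of differences of L_set0 completed by other differences shows
   that the index set is partitioned into n - j nonempty blocks (and j < n). If 0 < j < n - 1,
   some block I satisfies 2 <= |I| < n; for a in I and b outside, replace w_b by w_a + e w_b.
   For small e > 0 both I and (I minus a) plus b still carry a difference transversal to
   Phi {p}, by continuity. Since they overlap without being equal, this contradicts
   balancedness for the new basis. *)
Require Import Defs.
From HB Require Import structures.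
From mathcomp Require Import all_boot all_order all_algebra.
From mathcomp Require Import all_classical all_reals all_analysis measurable_realfun.
From mathcomp Require Import ring lra zify.
From mathcomp Require Import perm.
Import Order.TTheory GRing.Theory Num.Theory.
Import numFieldNormedType.Exports.
Import Defs.
Local Open Scope classical_set_scope.
Local Open Scope ring_scope.

Set Implicit Arguments. Unset Strict Implicit. Unset Printing Implicit Defensive.

(** * Volume of boxes and of their affine images *)

Section Volume.
Variable R : realType.

(* The weights c absorb the last coordinate when slicing, which drives the induction on n. *)
Lemma prod_le_weighted_cover n (t : nat -> R) (c : nat -> R) (a b : nat -> nat -> R) :
  (forall i, 0 <= t i) -> (forall k, 0 <= c k) ->
  (forall x : nat -> R, (forall i, (i < n)%N -> 0 <= x i <= t i) ->
    (1 <= \sum_(0 <= k <oo)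
      (c k * \prod_(i < n) (a k i <= x i <= b k i)%R%:R)%:E)%E) ->
  ((\prod_(i < n) t i)%:E <=
    \sum_(0 <= k <oo) (c k * \prod_(i < n) Num.max (b k i - a k i) 0)%:E)%E.
Proof.
move=> t0; elim: n c => [|n IH] c c0 cover.
  have := cover (fun=> 0) (fun i i0 => ltac:(by [])).
  rewrite big_ord0.
  by under eq_eseriesr do rewrite big_ord0;
    under [X in _ -> (_ <= X)%E]eq_eseriesr do rewrite big_ord0.
pose P k := c k * \prod_(i < n) Num.max (b k i - a k i) 0.
have P0 k : 0 <= P k.
  by rewrite mulr_ge0// prodr_ge0// => i _; rewrite le_max lexx orbT.
pose f k (y : measurableTypeR R) : \bar R := (P k * \1_`[a k n, b k n] y)%:E.
have slice (y : R) : y \in `[0, t n] ->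
    ((\prod_(i < n) t i)%:E <= \sum_(0 <= k <oo) f k y)%E.
  rewrite in_itv/= => y0t.
  have -> : (\sum_(0 <= k <oo) f k y = \sum_(0 <= k <oo)
      (c k * (a k n <= y <= b k n)%R%:R *
        \prod_(i < n) Num.max (b k i - a k i) 0)%:E)%E.
    apply: eq_eseriesr => k _; rewrite /f /P mulrAC; congr (_ * _ * _)%:E.
    by rewrite indicE mem_setE in_itv.
  apply: IH => [k|x xt]; first by rewrite mulr_ge0.
  pose x' (i : nat) : R := if i == n then y else x i.
  have -> : (\sum_(0 <= k <oo) (c k * (a k n <= y <= b k n)%R%:R *
      \prod_(i < n) (a k i <= x i <= b k i)%R%:R)%:E = \sum_(0 <= k <oo)
      (c k * \prod_(i < n.+1) (a k i <= x' i <= b k i)%R%:R)%:E)%E.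
    apply: eq_eseriesr => k _; rewrite big_ord_recr/=.
    rewrite -mulrA; congr (_ * _)%:E; rewrite mulrC; congr (_ * _); last by rewrite /x' eqxx.
    by apply: eq_bigr => i _; rewrite /x' ltn_eqF.
  apply: cover => i; rewrite ltnS leq_eqVlt /x'; case: eqP => [->//|_ /= ].
  exact: xt.
(* Integrating the slice inequality over [[0, t n]] multiplies the left side by [t n]; on the right,
   term k gains at most the length of the last side of box k. *)
pose D : set (measurableTypeR R) := [set` `[0, t n]].
have mD : measurable D by exact: measurable_itv.
have muD : lebesgue_measure D = (t n)%:E.
  have := lebesgue_measure_itv `[0, t n].
  rewrite /= lte_fin; case: ltP => [_|tn]; first by rewrite oppr0 adde0.
  by move=> ->; congr EFin; apply/eqP; rewrite eq_le tn t0.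
have mf k : measurable_fun D (f k).
  by apply/measurable_EFinP; apply: measurable_funM.
have f0 k y : (0 <= f k y)%E by rewrite lee_fin mulr_ge0.
have -> : (\prod_(i < n.+1) t i)%:E =
    (\int[lebesgue_measure]_(y in D) (\prod_(i < n) t i)%:E)%E.
  rewrite integral_cst// [X in (_ * X)%E](_ : _ = (t n)%:E); last exact: muD.
  by rewrite big_ord_recr.
have le1 : (\int[lebesgue_measure]_(y in D) (\prod_(i < n) t i)%:E <=
   \int[lebesgue_measure]_(y in D) \sum_(0 <= k <oo) f k y)%E.
  apply: ge0_le_integral => //.
  - by move=> x _; rewrite lee_fin prodr_ge0.
  - by apply: ge0_emeasurable_sum => // k _ x _.
apply: (le_trans le1); rewrite integral_nneseries//.
apply: lee_nneseries => [k _ _|k _]; first by apply: integral_ge0 => *; exact: f0.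
rewrite /f; under eq_integral do rewrite EFinM.
rewrite ge0_integralZl_EFin//; last first.
  by apply/measurable_EFinP; apply: measurable_indic; exact: measurable_itv.
rewrite big_ord_recr/= mulrA [leRHS]EFinM; apply: lee_wpmul2l; first by rewrite lee_fin.
rewrite integral_indic//; apply: (@le_trans _ _ (@lebesgue_measure R `[a k n, b k n])).
  by apply: le_measure; rewrite ?inE//; apply: measurableI.
rewrite lebesgue_measure_itv/= lte_fin; case: ltP => ab.
  by rewrite -EFinD lee_fin le_max lexx.
by rewrite lee_fin le_max lexx orbT.
Qed.

Variable n : nat.
Notation V := 'rV[R]_n.

Lemma boxvol_ge0 (a b : V) : 0 <= boxvol a b.
Proof. by apply: prodr_ge0 => i _; rewrite le_max lexx orbT. Qed.

Lemma volume_ge0 (A : set V) : (0 <= volume A)%E.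
Proof.
apply: le_ereal_inf_tmp => _ [a [b [_ ->]]].
by apply: nneseries_ge0 => k _ _; rewrite lee_fin boxvol_ge0.
Qed.

Lemma le_volume (A B : set V) : A `<=` B -> (volume A <= volume B)%E.
Proof.
move=> AB; apply: le_ereal_inf => r [a [b [cov ->]]].
by exists a, b; split=> //; apply: subset_trans cov.
Qed.

(** Every point of the box lies in some box of the cover, so [prod_le_weighted_cover] applies with
    all weights 1. *)
Lemma volume_box_ge (t : V) : (forall i, 0 <= t 0 i) ->
  ((\prod_i t 0 i)%:E <= volume (box 0 t))%E.
Proof.
move=> t0; apply: le_ereal_inf_tmp => _ [a [b [cov ->]]].
(* [ext] pads a row with zeros to a sequence, the form in which the inductive lemma takes points. *)
pose ext (x : V) (i : nat) := oapp (fun j => x 0 j) 0 (insub i).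
have extE x (i : 'I_n) : ext x i = x 0 i by rewrite /ext valK.
have -> : \prod_i t 0 i = \prod_(i < n) ext t i.
  by apply: eq_bigr => i _; rewrite extE.
have -> : (\sum_(0 <= k <oo) (boxvol (a k) (b k))%:E = \sum_(0 <= k <oo)
   (1 * \prod_(i < n) Num.max (ext (b k) i - ext (a k) i) 0)%:E)%E.
  apply: eq_eseriesr => k _; rewrite mul1r; congr EFin.
  by apply: eq_bigr => i _; rewrite !extE.
apply: (@prod_le_weighted_cover n (ext t) (fun=> 1) (fun k => ext (a k))
  (fun k => ext (b k))) => // [i|x xt].
  by rewrite /ext; case: insubP => [j _ _|_] /=.
have [|k _ xk] := cov (\row_i x i).
  by move=> i; rewrite !mxE -extE xt.
rewrite (nneseriesD1 (n := k))//; last first.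
  by move=> m _; rewrite lee_fin mul1r prodr_ge0.
rewrite mul1r big1 ?leeDl//; last first.
  by move=> i _; have := xk i; rewrite mxE !extE => ->.
by apply: nneseries_ge0 => m _ _; rewrite lee_fin mul1r prodr_ge0.
Qed.

(** The outer measure argument: cover [A m] within e / 2^(m+1) of its volume, then enumerate the
    doubly indexed family of boxes along a bijection of nat with its square. *)
Lemma volume_bigcup (A : nat -> set V) :
  (volume (\bigcup_k A k) <= \sum_(0 <= k <oo) volume (A k))%E.
Proof.
have [[i ioo]|] := pselect (exists i, volume (A i) = +oo%E).
  rewrite (eseries_pinfty _ _ ioo) ?leey// => m _.
  by rewrite -ltNye (lt_le_trans _ (volume_ge0 _)).
rewrite -forallNE => Aoo.
suff add2e (e : {posnum R}) : (volume (\bigcup_n A n) <=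
    \sum_(0 <= i <oo) volume (A i) + e%:num%:E)%E.
  by apply/lee_addgt0Pr => _/posnumP[].
rewrite (le_trans _ (epsilon_trick _ _ _))//; last first.
  by move=> m; exact: volume_ge0.
pose P m (B : nat -> V * V) := A m `<=` \bigcup_k box (B k).1 (B k).2 /\
  (\sum_(0 <= k <oo) (boxvol (B k).1 (B k).2)%:E <=
    volume (A m) + (e%:num / (2 ^ m.+1)%:R)%:E)%E.
have [G PG] : {G : nat -> nat -> V * V & forall m, P m (G m)}.
  apply: (@choice _ _ P) => m; rewrite /P.
  have fin : volume (A m) \is a fin_num.
    by rewrite ge0_fin_numE ?volume_ge0// ltey; apply/eqP; exact: Aoo.
  have en1 : 0 < e%:num / (2 ^ m.+1)%:R by [].
  have [_ [a [b [cov ->]]] /ltW le1] := lb_ereal_inf_adherent en1 fin.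
  by exists (fun k => (a k, b k)).
pose g (x : nat * nat) := (boxvol (G x.1 x.2).1 (G x.1 x.2).2)%:E.
have g0 x : (0 <= g x)%E by rewrite lee_fin boxvol_ge0.
have /card_esym/ppcard_eqP[f] := card_nat2.
apply: (@le_trans _ _ (\esum_(i in setT) g i)%E).
  apply: ereal_inf_lbound => /=.
  exists (fun i => (G (f i).1 (f i).2).1), (fun i => (G (f i).1 (f i).2).2).
  split.
    move=> x [m _] /((PG m).1) [k _ xk]; exists (f^-1%FUN (m, k)) => //=.
    by rewrite invK ?inE.
  rewrite -(esum_pred_image g f xpredT) ?[fun=> _]set_true//.
  apply: (congr1 (fun S => \esum_(i in S) g i)%E); apply/seteqP; split=> // y _.
  by exists (f^-1%FUN y) => //; rewrite invK ?inE.
have -> : (\esum_(i in setT) g i = \sum_(0 <= i <oo) \sum_(0 <= j <oo) g (i, j))%E.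
  rewrite nneseries_esumT; last first.
    by move=> m; apply: nneseries_ge0 => *; exact: g0.
  under [RHS]eq_esum do rewrite nneseries_esumT//.
  rewrite esum_esum//.
  rewrite (_ : setT = setT `*`` (fun=> setT)); last by apply/seteqP; split.
  by apply: eq_esum => -[].
apply: lee_nneseries => [*|m *]; last exact: (PG m).2.
by apply: nneseries_ge0 => *; exact: g0.
Qed.

Lemma boxvol00 : (0 < n)%N -> boxvol (0 : V) 0 = 0.
Proof.
by move=> n0; rewrite /boxvol (bigD1 (Ordinal n0))//= !mxE subrr maxxx mul0r.
Qed.

(** For n > 0 a degenerate box has volume 0, so the pair can be continued by empty sets to a
    sequence. *)
Lemma volume_setU (A B : set V) :
  (0 < n)%N -> (volume (A `|` B) <= volume A + volume B)%E.
Proof.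
move=> n0; pose F k := nth (set0 : set V) [:: A; B] k.
have v0 : volume (set0 : set V) = 0%E.
  apply/eqP; rewrite eq_le volume_ge0 andbT; apply: ereal_inf_lbound.
  exists (fun=> 0), (fun=> 0); split=> //.
  rewrite eseries0// => k _ _; congr EFin.
  by rewrite boxvol00.
have -> : A `|` B = \bigcup_k F k.
  apply/seteqP; split=> [x [Ax|Bx]|x [[|[|k]] _]]; rewrite /F/=.
  - by exists 0%N.
  - by exists 1%N.
  - by left.
  - by right.
  - by rewrite nth_nil.
apply: (le_trans (volume_bigcup F)).
rewrite (nneseries_split _ 2) => [|k _]; last exact: volume_ge0.
rewrite eseries0 ?adde0 => [|k k2 _]; last first.
  by rewrite /F; case: k k2 => [|[|k]]//= _; rewrite nth_nil v0.
by rewrite big_nat_recl// big_nat1.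
Qed.

Definition affine_image (T : 'M[R]_n) (c : V) (A : set V) : set V :=
  [set x *m T + c | x in A].

(* Induction on the number of cells of side d, cutting off one layer at a time; the image of
   a single cell fits in a cube of side M * d. *)
Lemma volume_affine_cells (T : 'M[R]_n) (c : V) (M d : R) :
  (0 < n)%N -> 0 < d -> (forall j, \sum_i `|T i j| <= M) ->
  forall (N : 'I_n -> nat) (a b : V),
  (forall i, (0 < N i)%N) -> (forall i, b 0 i - a 0 i <= (N i)%:R * d) ->
  (volume (affine_image T c (box a b)) <=
    ((\prod_i (N i)%:R) * (M * d) ^+ n)%:E)%E.
Proof.
move=> n0 d0 TM N; have [m] := ubnP (\sum_i N i); elim: m N => // m IH N.
move=> leNm a b N0 abN.
have Md0 : 0 <= M * d.
  by apply: mulr_ge0 (ltW d0); apply: le_trans (TM (Ordinal n0)); rewrite sumr_ge0.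
have [/forallP N1|/forallPn[i Ni]] := boolP [forall i, N i == 1%N].
  rewrite big1 ?mul1r => [|i _]; last by rewrite (eqP (N1 i)).
  (* [a'] takes, in each coordinate, the least value of [x *m T + c] over the cube of side d at
     a. *)
  pose a' : V :=
    (\row_j \sum_i Num.min (a 0 i * T i j) (a 0 i * T i j + T i j * d)) + c.
  pose b' : V := a' + const_mx (M * d).
  have box1 : boxvol a' b' = (M * d) ^+ n.
    rewrite /boxvol (eq_bigr (fun=> M * d)) ?prodr_const ?card_ord// => j _.
    by rewrite /b' mxE addrAC subrr add0r mxE max_l.
  apply: ereal_inf_lbound => /=.
  exists (fun k => if k == 0%N then a' else 0), (fun k => if k == 0%N then b' else 0).
  split; last first.
    rewrite (nneseries_split _ 1) => [|k _]; last by rewrite lee_fin boxvol_ge0.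
    rewrite big_nat1/= box1 eseries0 ?adde0// => -[|k]//= _ _.
    by rewrite boxvol00.
  move=> _ [x xab <-]; exists 0%N => //= j; rewrite !mxE.
  have step i : Num.min (a 0 i * T i j) (a 0 i * T i j + T i j * d) <= x 0 i * T i j
      <= Num.min (a 0 i * T i j) (a 0 i * T i j + T i j * d) + `|T i j| * d.
    have /andP[ax xb] := xab i; have := abN i; rewrite (eqP (N1 i)) mul1r => abd.
    rewrite /Num.min; case: ifP => [|/negbT]; rewrite -?leNgt.
      rewrite ltrDl pmulr_lgt0// => T0; rewrite gtr0_norm//; nra.
    rewrite gerDl pmulr_lle0// => T0; rewrite ler0_norm//; nra.
  apply/andP; split.
    by rewrite lerD2r; apply: ler_sum => i _; case/andP: (step i).
  rewrite addrAC lerD2r.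
  apply: (@le_trans _ _ (\sum_i (Num.min (a 0 i * T i j) (a 0 i * T i j + T i j * d)
     + `|T i j| * d))).
    by apply: ler_sum => i _; case/andP: (step i).
  by rewrite big_split/= lerD2l -mulr_suml ler_wpM2r// ltW.
have Ni1 : (1 < N i)%N by rewrite ltn_neqAle eq_sym Ni N0.
pose b1 : V := \row_j if j == i then a 0 i + d else b 0 j.
pose a2 : V := \row_j if j == i then a 0 i + d else a 0 j.
pose N1 j := if j == i then 1%N else N j.
pose N2 j := if j == i then (N i).-1 else N j.
have cov : affine_image T c (box a b) `<=`
    affine_image T c (box a b1) `|` affine_image T c (box a2 b).
  move=> _ [x xab <-]; have [xi|xi] := leP (x 0 i) (a 0 i + d).
    left; exists x => // j; rewrite mxE; case: eqP => [->|_]; last exact: xab.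
    by rewrite xi; case/andP: (xab i) => ->.
  right; exists x => // j; rewrite mxE; case: eqP => [->|_]; last exact: xab.
  by rewrite (ltW xi); case/andP: (xab i) => _ ->.
apply: (le_trans (le_volume cov)); apply: (le_trans (volume_setU _ _ n0)).
have prodE (N' : 'I_n -> nat) : (forall j, j != i -> N' j = N j) ->
    \prod_j (N' j)%:R = (N' i)%:R * \prod_(j | j != i) (N j)%:R :> R.
  by move=> E; rewrite (bigD1 i)//=; congr (_ * _); apply: eq_bigr => j /E ->.
have sumE (N' : 'I_n -> nat) : (forall j, j != i -> N' j = N j) ->
    (\sum_j N' j = N' i + \sum_(j | j != i) N j)%N.
  by move=> E; rewrite (bigD1 i)//=; congr (_ + _)%N; apply: eq_bigr => j /E ->.
have E1 j : j != i -> N1 j = N j by rewrite /N1 => /negbTE ->.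
have E2 j : j != i -> N2 j = N j by rewrite /N2 => /negbTE ->.
have N1i : N1 i = 1%N by rewrite /N1 eqxx.
have N2i : N2 i = (N i).-1 by rewrite /N2 eqxx.
move: leNm; rewrite (sumE N)// => leNm.
have v1 := IH N1; rewrite (sumE N1)// in v1.
have v2 := IH N2; rewrite (sumE N2)// in v2.
apply: (le_trans (leeD (v1 _ _ _ _ _) (v2 _ _ _ _ _))).
- by rewrite N1i; lia.
- by move=> j; rewrite /N1; case: eqP.
- move=> j; rewrite /N1 mxE; case: eqP => [->|_]; last exact: abN.
  by rewrite mul1r addrAC subrr add0r.
- by rewrite N2i; lia.
- by move=> j; rewrite /N2; case: eqP => // _; lia.
- move=> j; rewrite /N2 mxE; case: eqP => [->|_]; last exact: abN.
  rewrite -subn1 natrB ?N0//; have := abN i; lra.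
rewrite -EFinD lee_fin (prodE N1)// (prodE N2)// (prodE N)// N1i N2i.
rewrite -!mulrDl -natrD; by have -> : (1 + (N i).-1 = N i)%N by lia.
Qed.

(** At most t_i / e + 1 cells of side e are needed in direction i, which bounds the volume by
    [M ^+ n] times the product of the [t i + e]; then e tends to 0. B depends on T only. *)
Lemma volume_affine_box (T : 'M[R]_n) : (0 < n)%N ->
  exists2 B : R, 0 < B & forall c a b,
    (volume (affine_image T c (box a b)) <= (B * boxvol a b)%:E)%E.
Proof.
move=> n0; pose M := 1 + \sum_j \sum_i `|T i j|.
have M0 : 0 < M by rewrite ltr_pwDl// sumr_ge0// => i _; rewrite sumr_ge0.
have TM j : \sum_i `|T i j| <= M.
  rewrite /M [X in _ <= 1 + X](bigD1 j)//= addrCA lerDl addr_ge0// sumr_ge0// => k _.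
  by rewrite sumr_ge0.
exists (M ^+ n); first by rewrite exprn_gt0.
move=> c a b.
pose t i := Num.max (b 0 i - a 0 i) 0.
have t0 i : 0 <= t i by rewrite le_max lexx orbT.
have enlarged e : 0 < e -> (volume (affine_image T c (box a b)) <=
    (M ^+ n * \prod_i (t i + e))%:E)%E.
  move=> e0.
  pose N i := (Num.truncn (t i / e)).+1.
  have Nle i : (N i)%:R * e <= t i + e.
    rewrite -natr1 mulrDl mul1r lerD2r -ler_pdivlMr//.
    by rewrite truncn_le// divr_ge0// ltW.
  have leN i : b 0 i - a 0 i <= (N i)%:R * e.
    rewrite -ler_pdivrMr//; apply: (@le_trans _ _ (t i / e)).
      by rewrite ler_pM2r ?invr_gt0// le_max lexx.
    by apply/ltW/truncnS_gt.
  apply: (le_trans (volume_affine_cells c n0 e0 TM (N := N) _ leN)) => //.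
  rewrite lee_fin exprMn mulrCA ler_pM2l ?exprn_gt0//.
  have -> : e ^+ n = \prod_(i < n) e by rewrite prodr_const card_ord.
  rewrite -big_split/= ler_prod// => i _.
  by rewrite Nle mulr_ge0// ltW.
(* The bound as a polynomial in e, for its continuity at 0. *)
pose q := (M ^+ n)%:P * \prod_i ((t i)%:P + 'X).
have qE e : q.[e] = M ^+ n * \prod_i (t i + e).
  rewrite hornerM hornerC horner_prod; congr (_ * _).
  by apply: eq_bigr => i _; rewrite hornerD hornerC hornerX.
apply/lee_addgt0Pr => h h0.
have : \forall e \near (0 : R), `|q.[0] - q.[e]| < h.
  by have /cvgrPdist_lt := @continuous_horner R q 0; apply.
move=> /nbhs_ballP[r /= r0 qr].
have r2 : 0 < r / 2 by rewrite divr_gt0.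
have := qr (r / 2); rewrite -ball_normE/= sub0r normrN gtr0_norm//.
move=> /(_ _); rewrite ltr_pdivrMr// ltr_pMr// ltr1n => /(_ isT).
rewrite ltr_norml => /andP[qh _].
apply: (le_trans (enlarged _ r2)); rewrite -qE -EFinD lee_fin.
have -> : boxvol a b = \prod_i (t i + 0) by apply: eq_bigr => i _; rewrite addr0.
by rewrite -qE; lra.
Qed.

Lemma affine_imageK (T : 'M[R]_n) c : T \in unitmx ->
  forall x : V, (x *m T + c - c) *m invmx T = x.
Proof. by move=> Tu x; rewrite addrK mulmxK. Qed.

Lemma volume_affine_le (T : 'M[R]_n) : (0 < n)%N ->
  exists2 B : R, 0 < B & forall c A,
    (volume (affine_image T c A) <= B%:E * volume A)%E.
Proof.
move=> n0; have [B B0 leB] := volume_affine_box T n0; exists B => // c A.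
rewrite -lee_pdivrMl//.
apply: le_ereal_inf_tmp => _ [a [b [cov ->]]].
rewrite lee_pdivrMl//.
apply: (@le_trans _ _ (volume (\bigcup_k affine_image T c (box (a k) (b k))))).
  by apply: le_volume => _ [x /cov[k _ xk] <-]; exists k => //; exists x.
apply: (le_trans (volume_bigcup _)); rewrite -nneseriesZl//; last first.
  by move=> k _; rewrite lee_fin boxvol_ge0.
by apply: lee_nneseries => k *; [exact: volume_ge0|exact: leB].
Qed.

(** The inverse map returns the parallelepiped to the box and enlarges volume at most by a constant
    factor. *)
Lemma volume_parallelepiped_ge (T : 'M[R]_n) : (0 < n)%N -> T \in unitmx ->
  exists2 B : R, 0 < B & forall c (t : V), (forall i, 0 <= t 0 i) ->
    ((B * \prod_i t 0 i)%:E <= volume (affine_image T c (box 0 t)))%E.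
Proof.
move=> n0 Tu; have [B B0 leB] := volume_affine_le (invmx T) n0.
exists B^-1; first by rewrite invr_gt0.
move=> c t t0; have := leB (- c *m invmx T) (affine_image T c (box 0 t)).
have -> : affine_image (invmx T) (- c *m invmx T) (affine_image T c (box 0 t)) = box 0 t.
  apply/seteqP; split=> [_ [_ [x xb <-] <-]|x xb].
    by rewrite -mulmxDl affine_imageK.
  exists (x *m T + c); first by exists x.
  by rewrite -mulmxDl affine_imageK.
move=> /(le_trans (volume_box_ge t0)) le1.
by rewrite EFinM lee_pdivrMl.
Qed.

(** Solving for a coordinate m with u_m nonzero places A inside the affine image of a box whose m-th
    side is degenerate. *)
Lemma volume_hyperplane (u : V) (r : R) (A : set V) : (0 < n)%N -> u != 0 ->
  (exists a b, A `<=` box a b) -> (forall x, A x -> \sum_i x 0 i * u 0 i = r) ->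
  volume A = 0%E.
Proof.
move=> n0 u0 [a [b Aab]] Ar.
have [m um] : exists m, u 0 m != 0.
  by apply/existsP; apply: contraNT u0; rewrite negb_exists => /forallP u0;
    apply/eqP/rowP => i; rewrite mxE; apply/eqP/negPn/u0.
(* a point of the hyperplane is an affine function of its other coordinates *)
pose S : 'M[R]_n := \matrix_(i, j) if j == m then - u 0 i / u 0 m else (i == j)%:R.
pose c : V := \row_j if j == m then r / u 0 m else 0.
pose flat (x : V) : V := \row_j if j == m then 0 else x 0 j.
have [B B0 leB] := volume_affine_box S n0.
apply/eqP; rewrite eq_le volume_ge0 andbT.
have flat0 : boxvol (flat a) (flat b) = 0.
  by rewrite /boxvol (bigD1 m)//= !mxE eqxx subrr maxxx mul0r.
have := leB c (flat a) (flat b); rewrite flat0 mulr0; apply: le_trans.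
apply: le_volume => x Ax; exists (flat x).
  by move=> j; rewrite !mxE; case: eqP => _; [rewrite lexx|exact: Aab].
apply/rowP => j; rewrite !mxE; case: eqP => [->|/eqP jm].
  rewrite (bigD1 m)//= !mxE eqxx mul0r add0r -(Ar _ Ax).
  rewrite [X in _ + X / _](bigD1 m)//=.
  rewrite mulrDl mulfK// addrCA mulr_suml -big_split/= big1 ?addr0// => i im.
  by rewrite !mxE (negbTE im) eqxx; ring.
rewrite (bigD1 j)//= !mxE (negbTE jm) eqxx mulr1 big1 ?addr0// => i ij.
by rewrite !mxE (negbTE jm) (negbTE ij) mulr0.
Qed.

End Volume.

(** * Convex bodies and support functions *)

Section Bodies.
Variables (R : realType) (n : nat).
Notation V := 'rV[R]_n.
Implicit Types (x y u v : V) (K L : set V).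

Definition dot x u : R := \sum_i x 0 i * u 0 i.

Lemma dotC x u : dot x u = dot u x.
Proof. by apply: eq_bigr => i _; rewrite mulrC. Qed.

Lemma dotDl x y u : dot (x + y) u = dot x u + dot y u.
Proof. by rewrite -big_split; apply: eq_bigr => i _; rewrite mxE mulrDl. Qed.

Lemma dotZl r x u : dot (r *: x) u = r * dot x u.
Proof. by rewrite mulr_sumr; apply: eq_bigr => i _; rewrite mxE mulrA. Qed.

Lemma dotNl x u : dot (- x) u = - dot x u.
Proof. by rewrite -scaleN1r dotZl mulN1r. Qed.

Lemma dotBl x y u : dot (x - y) u = dot x u - dot y u.
Proof. by rewrite dotDl dotNl. Qed.

Lemma dotNr x u : dot x (- u) = - dot x u.
Proof. by rewrite dotC dotNl dotC. Qed.

Lemma dotDr x u v : dot x (u + v) = dot x u + dot x v.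
Proof. by rewrite dotC dotDl !(dotC x). Qed.

Lemma dotBr x u v : dot x (u - v) = dot x u - dot x v.
Proof. by rewrite dotDr dotNr. Qed.

Lemma dot_suml (I : Type) (r : seq I) (P : pred I) (F : I -> V) u :
  dot (\sum_(i <- r | P i) F i) u = \sum_(i <- r | P i) dot (F i) u.
Proof.
elim/big_rec2: _ => [|i a b _ <-]; last by rewrite dotDl.
by rewrite /dot big1// => i _; rewrite mxE mul0r.
Qed.

Lemma dot_delta x i : dot x (delta_mx 0 i) = x 0 i.
Proof.
rewrite /dot (bigD1 i)//= mxE !eqxx mulr1 big1 ?addr0// => j ji.
by rewrite mxE (negbTE ji) andbF mulr0.
Qed.

Lemma dot_ge0 x : 0 <= dot x x.
Proof. by apply: sumr_ge0 => i _; rewrite -expr2 sqr_ge0. Qed.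

Lemma dot_eq0 x : (dot x x == 0) = (x == 0).
Proof.
apply/eqP/eqP => [|->]; last by rewrite /dot big1// => i _; rewrite mxE mul0r.
move=> /eqP; rewrite psumr_eq0 => [/allP x0|i _]; last by rewrite -expr2 sqr_ge0.
apply/rowP => i; rewrite mxE; apply/eqP.
by have := x0 i (mem_index_enum _); rewrite /= mulf_eq0 orbb.
Qed.

Lemma cvg_sum_fun (T I : Type) (F : set_system T) (FF : Filter F) (r : seq I)
    (P : pred I) (f : I -> T -> R) (l : I -> R) :
  (forall i, f i x @[x --> F] --> l i) ->
  \sum_(i <- r | P i) f i x @[x --> F] --> \sum_(i <- r | P i) l i.
Proof.
move=> fl; elim: r => [|i r IH].
  by rewrite big_nil; under eq_fun do rewrite big_nil; exact: cvg_cst.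
rewrite big_cons; under eq_fun do rewrite big_cons.
by case: (P i) => //; apply: cvgD IH; exact: fl.
Qed.

Lemma continuous_sum_fun (T : topologicalType) (I : Type) (r : seq I)
    (F : I -> T -> R) :
  (forall i, continuous (F i)) -> continuous (fun x : T => \sum_(i <- r) F i x).
Proof. by move=> cF x; apply: cvg_sum_fun => i; exact: cF. Qed.

Lemma continuous_dot u : continuous (dot^~ u).
Proof.
apply: continuous_sum_fun => i x.
have cu := @cst_continuous V R (u 0 i) x.
exact: cvgM (@coord_continuous R 1 n 0 i x) cu.
Qed.

Lemma continuous_rowP (T : topologicalType) (f : T -> V) :
  (forall i, continuous (fun x : T => f x 0 i)) -> continuous f.
Proof.
move=> cf x B [P fP PB].
suff : \forall y \near x, forall i, P 0 i (f y 0 i).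
  by apply: filterS => y Py; apply: PB => i j; rewrite ord1; exact: Py.
by apply: filter_forall => i; exact: (cf i x _ (fP 0 i)).
Qed.

Lemma continuous_affine (T : 'M[R]_n) (c : V) : continuous (fun x : V => x *m T + c).
Proof.
apply: continuous_rowP => i x.
rewrite (_ : (fun _ => _) = fun y : V => dot y (row i T^T) + c 0 i).
  have cc := @cst_continuous V R (c 0 i) x.
  exact: cvgD (@continuous_dot _ x) cc.
apply/funext => y; rewrite !mxE; congr (_ + _).
by apply: eq_bigr => j _; rewrite !mxE.
Qed.

Lemma compact_box (a b : V) : compact (box a b).
Proof.
have := @rV_compact R n (fun i => [set` `[a 0 i, b 0 i]]) (fun i => @segment_compact _ _ _).
congr (compact _); apply/seteqP; split=> x /= xab i; have := xab i; by rewrite in_itv.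
Qed.

Lemma body_affine_box (T : 'M[R]_n) (c a b : V) : (forall i, a 0 i <= b 0 i) ->
  convex_body (affine_image T c (box a b)).
Proof.
move=> ab; split; first by exists (a *m T + c), a => // i; rewrite lexx ab.
split.
  apply: continuous_compact; last exact: compact_box.
  by apply: continuous_subspaceT; exact: continuous_affine.
move=> _ _ t [x xb <-] [y yb <-] t0 t1.
exists ((1 - t) *: x + t *: y).
  by move=> i; rewrite !mxE; have /andP[? ?] := xb i; have /andP[? ?] := yb i;
    apply/andP; split; nra.
by rewrite mulmxDl -!scalemxAl !scalerDr addrACA -scalerDl subrK scale1r.
Qed.

Lemma body_set1 x : convex_body [set x].
Proof.
split; first by exists x.
split; first exact: compact_set1.
by move=> _ _ t -> -> _ _; rewrite -scalerDl subrK scale1r.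
Qed.

Definition supp K u : R := sup [set dot x u | x in K].

Lemma supp_attained K u : convex_body K ->
  exists x, [/\ K x, dot x u = supp K u & forall y, K y -> dot y u <= supp K u].
Proof.
move=> [K0 [cK _]].
have [|x /set_mem Kx xmax] := @compact_EVT_max _ R (dot^~ u) K K0 cK.
  by apply: continuous_subspaceT; exact: continuous_dot.
have {}xmax y : K y -> dot y u <= dot x u by move=> Ky; apply: xmax; exact: mem_set.
suff <- : dot x u = supp K u by exists x.
apply/eqP; rewrite eq_le; apply/andP; split.
  by apply: ub_le_sup; [exists (dot x u) => _ [y Ky <-]; exact: xmax|exists x].
by apply: ge_sup => [|_ [y Ky <-]]; [exists (dot x u), x|exact: xmax].
Qed.

Lemma dot_le_supp K x u : convex_body K -> K x -> dot x u <= supp K u.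
Proof. by move=> bK Kx; have [_ [_ _]] := supp_attained u bK; exact. Qed.

Lemma supp_msum K L u : convex_body K -> convex_body L ->
  supp (msum K L) u = supp K u + supp L u.
Proof.
move=> bK bL; have [x [Kx xu xmax]] := supp_attained u bK.
have [y [Ly yu ymax]] := supp_attained u bL.
have ub z : msum K L z -> dot z u <= supp K u + supp L u.
  by move=> [a Ka [b Lb <-]]; rewrite dotDl lerD ?xmax ?ymax.
apply/eqP; rewrite eq_le; apply/andP; split.
  apply: ge_sup => [|_ [z KLz <-]]; last exact: ub.
  by exists (dot (x + y) u), (x + y) => //; exists x => //; exists y.
rewrite -xu -yu -dotDl; apply: ub_le_sup.
  by exists (supp K u + supp L u) => _ [z KLz <-]; exact: ub.
by exists (x + y) => //; exists x => //; exists y.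
Qed.

(** Separation by the nearest point: if y minimises the distance to x over K, then u = x - y
    satisfies [dot z u <= dot y u] for all z in K, and the hypothesis for this u forces x = y. *)
Lemma mem_body K x : convex_body K -> (forall u, dot x u <= supp K u) -> K x.
Proof.
move=> bK xK; have [K0 [cK convK]] := bK.
have [|y /set_mem Ky ymin] := @compact_EVT_min _ R (fun y => dot (x - y) (x - y)) K K0 cK.
  apply: continuous_subspaceT => y; apply: continuous_sum_fun => i z.
  rewrite (_ : (fun _ => _) = fun w : V => (x 0 i - w 0 i) * (x 0 i - w 0 i)).
    have cx := @cst_continuous V R (x 0 i) z.
    have cm := @coord_continuous R 1 n 0 i z.
    exact: cvgM (cvgB cx cm) (cvgB cx cm).
  by apply/funext => w; rewrite !mxE.
have {}ymin z : K z -> dot (x - y) (x - y) <= dot (x - z) (x - z).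
  by move=> Kz; apply: ymin; exact: mem_set.
have proj z : K z -> dot (z - y) (x - y) <= 0.
  move=> Kz; rewrite leNgt; apply/negP => pos.
  pose p := dot (z - y) (x - y); pose q := dot (z - y) (z - y).
  have q0 : 0 <= q by exact: dot_ge0.
  (* Moving from y towards z by t changes the squared distance by t (t q - 2 p), negative as t q <
     p; the denominator p + q also keeps t at most 1. *)
  pose t := p / (p + q).
  have pq0 : 0 < p + q by rewrite ltr_pwDl.
  have t0 : 0 < t by rewrite divr_gt0.
  have t1 : t <= 1 by rewrite ler_pdivrMr// mul1r lerDl.
  have := ymin _ (convK y z t Ky Kz (ltW t0) t1).
  have -> : x - ((1 - t) *: y + t *: z) = (x - y) - t *: (z - y).
    by apply/rowP => i; rewrite !mxE; ring.
  have -> : dot (x - y - t *: (z - y)) (x - y - t *: (z - y)) =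
      dot (x - y) (x - y) - 2 * (t * p) + t * (t * q).
    rewrite /p /q; move: (x - y) (z - y) => a b.
    rewrite dotBl !dotBr [dot a (t *: b)]dotC !dotZl [dot b (t *: b)]dotC dotZl.
    by ring.
  have tpq : t * (p + q) = p by rewrite mulfVK// gt_eqF.
  have tp0 : 0 < t * p by rewrite mulr_gt0.
  by rewrite mulrDr in tpq; nra.
have [z [Kz zu _]] := supp_attained (x - y) bK.
have le0 : dot (x - y) (x - y) <= 0.
  move: (proj z Kz) (xK (x - y)); rewrite -zu.
  rewrite dotBl; have -> : dot (x - y) (x - y) = dot x (x - y) - dot y (x - y).
    by rewrite dotBl.
  by lra.
have /eqP : dot (x - y) (x - y) == 0 by rewrite eq_le le0 dot_ge0.
move/eqP; rewrite dot_eq0 subr_eq0 => /eqP xy.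
by rewrite xy.
Qed.

Lemma body_bounded K : convex_body K ->
  exists2 M : R, 0 <= M & forall x i, K x -> `|x 0 i| <= M.
Proof.
move=> bK.
pose M := \sum_i (`|supp K (delta_mx 0 i)| + `|supp K (- delta_mx 0 i)|).
exists M => [|x i Kx]; first by apply: sumr_ge0 => i _; rewrite addr_ge0.
rewrite /M (bigD1 i)//= (@le_trans _ _ (`|supp K (delta_mx 0 i)| + `|supp K (- delta_mx 0 i)|))//.
  have := dot_le_supp (delta_mx 0 i) bK Kx; have := dot_le_supp (- delta_mx 0 i) bK Kx.
  rewrite dotNr dot_delta => h1 h2.
  have := ler_norm (supp K (delta_mx 0 i)); have := ler_norm (supp K (- delta_mx 0 i)).
  by have [? ?] := (normr_ge0 (supp K (delta_mx 0 i)), normr_ge0 (supp K (- delta_mx 0 i)));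
    rewrite ler_norml; lra.
by rewrite lerDl; apply: sumr_ge0 => j _; rewrite addr_ge0.
Qed.

Lemma norm_le_edist x y i : `|x 0 i - y 0 i| <= edist x y.
Proof.
rewrite -sqrtr_sqr /edist ler_wsqrtr// (bigD1 i)//= lerDl.
by apply: sumr_ge0 => j _; rewrite sqr_ge0.
Qed.

Lemma euclidean_dist_ge0 x y : 0 <= edist x y.
Proof. exact: sqrtr_ge0. Qed.

Lemma edist_shift x v r : edist x (x + r *: v) = `|r| * edist v 0.
Proof.
rewrite /edist -sqrtr_sqr -sqrtrM ?sqr_ge0// mulr_sumr; congr Num.sqrt.
by apply: eq_bigr => i _; rewrite !mxE subr0 -exprMn; ring.
Qed.

Lemma hausdorff_lt K L e d : 0 <= e -> e < d -> hclose e K L -> hausdorff K L < d.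
Proof.
move=> e0 ed clo; apply: le_lt_trans ed; apply: ge_inf; last by split.
by exists 0 => r [].
Qed.

(** Matched points of the two bodies differ by at most e in every coordinate, hence by at most e
    times the sum of the |u_i| along u. *)
Lemma supp_hausdorff K L e u : convex_body K -> convex_body L ->
  hausdorff K L < e -> `|supp K u - supp L u| <= e * \sum_i `|u 0 i|.
Proof.
move=> bK bL KLe.
have [M M0 KM] := body_bounded bK; have [N N0 LN] := body_bounded bL.
(* Boundedness provides an admissible distance, so the infimum defining [hausdorff] runs over a
   nonempty set. *)
have dist_le x y : K x -> L y -> edist x y <= Num.sqrt (\sum_(i < n) (M + N) ^+ 2).
  move=> Kx Ly; rewrite ler_wsqrtr//; apply: ler_sum => i _.
  rewrite -[leLHS]ger0_norm ?sqr_ge0// normrX lerXn2r ?nnegrE ?addr_ge0//.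
  by rewrite (le_trans (ler_normB _ _))// lerD ?KM ?LN.
have [|d [d0 [clo1 clo2]] de] := inf_lt _ KLe.
  exists (Num.sqrt (\sum_(i < n) (M + N) ^+ 2)); split; first exact: sqrtr_ge0.
  have [[x Kx] _] := bK; have [[y Ly] _] := bL.
  by split=> [z Kz|z Lz]; [exists y => //|exists x => //]; exact: dist_le.
have dot_edist x y : edist x y <= d -> `|dot x u - dot y u| <= e * \sum_i `|u 0 i|.
  move=> xyd; rewrite -dotBl mulr_sumr; apply: (le_trans (ler_norm_sum _ _ _)).
  apply: ler_sum => i _; rewrite normrM ler_wpM2r// !mxE.
  exact: le_trans (norm_le_edist x y i) (le_trans xyd (ltW de)).
have [x [Kx <- xmax]] := supp_attained u bK.
have [y [Ly <- ymax]] := supp_attained u bL.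
rewrite ler_norml; apply/andP; split.
  have [z Kz zy] := clo2 y Ly; have := dot_edist _ _ zy.
  by rewrite ler_norml => /andP[+ _]; have := xmax z Kz; lra.
have [z Lz zx] := clo1 x Kx; have := dot_edist _ _ zx.
by rewrite ler_norml => /andP[_ +]; have := ymax z Lz; lra.
Qed.

End Bodies.

(** * Multiaffine expansion on parallelepipeds *)

(** Cauchy's equation on the half-line. Subtracting the affine candidate leaves an additive H with H
    1 = 0, so H vanishes at multiples of 1/N; hence H t = H r with 0 <= r < 1/N, which is small by
    continuity at 0. *)
Lemma cauchy_affine (R : realType) (G : R -> R) :
  (forall s t, 0 <= s -> 0 <= t -> G (s + t) + G 0 = G s + G t) ->
  (forall e, 0 < e -> exists2 d, 0 < d & forall t, 0 <= t -> t < d -> `|G t - G 0| < e) ->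
  forall t, 0 <= t -> G t = G 0 + t * (G 1 - G 0).
Proof.
move=> addG contG t t0.
pose H x := G x - G 0 - x * (G 1 - G 0).
have HD x y : 0 <= x -> 0 <= y -> H (x + y) = H x + H y.
  by move=> x0 y0; have := addG x y x0 y0; rewrite /H; lra.
have HM m x : 0 <= x -> H (m%:R * x) = m%:R * H x.
  move=> x0; elim: m => [|m IH]; first by rewrite !mul0r /H mul0r; ring.
  by rewrite -natr1 !mulrDl !mul1r HD ?IH// mulr_ge0.
suff H0 : H t = 0 by move: H0; rewrite /H; lra.
apply/eqP; rewrite -normr_le0; apply/ler_addgt0Pl => e e0.
have [d d0 Gd] := contG (e / 2) ltac:(lra).
pose c := `|G 1 - G 0| + 1.
have c0 : 0 < c by rewrite ltr_wpDl.
(* N > 1/d gives r < d, and N > c / (e / 2) keeps the linear part of H r below e / 2. *)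
pose q := d^-1 + c / (e / 2).
have q0 : 0 < q by rewrite addr_gt0 ?invr_gt0 ?divr_gt0.
pose N := (Num.truncn q).+1.
have qN : q < N%:R by exact: truncnS_gt.
have N0 : 0 < N%:R :> R by exact: lt_trans qN.
pose m := Num.truncn (N%:R * t).
pose r := t - m%:R / N%:R.
have r0 : 0 <= r.
  by rewrite subr_ge0 ler_pdivrMr// mulrC truncn_le// mulr_ge0// ltW.
have rN : r * N%:R < 1.
  rewrite mulrBl divfK ?gt_eqF// ltrBlDr addrC natr1 mulrC; exact: truncnS_gt.
have HN : H N%:R^-1 = 0.
  have := HM N N%:R^-1; rewrite divff ?gt_eqF// invr_ge0 ltW// => /(_ isT).
  have -> : H 1 = 0 by rewrite /H; ring.
  by move/esym/eqP; rewrite mulf_eq0 gt_eqF//= => /eqP.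
have Hr : H t = H r.
  have -> : t = m%:R / N%:R + r by rewrite addrC subrK.
  by rewrite HD ?divr_ge0// ?HM ?HN ?mulr0 ?add0r// invr_ge0 ltW.
rewrite Hr addr0.
have rd : r < d.
  have : d^-1 < N%:R by apply: lt_trans qN; rewrite ltrDl divr_gt0// divr_gt0.
  by rewrite -ltf_pV2 ?posrE ?invr_gt0// invrK; apply: le_lt_trans;
    rewrite -[leRHS]mul1r ler_pdivlMr// ltW.
have rc : r * c < e / 2.
  have : c / (e / 2) < N%:R by apply: lt_trans qN; rewrite ltrDr invr_gt0.
  rewrite ltr_pdivrMr; last by lra.
  move=> cN; rewrite -(ltr_pM2r N0) mulrAC; apply: lt_trans (_ : c < _); last by rewrite mulrC.
  by rewrite -[ltRHS]mul1r ltr_pM2r.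
rewrite /H; apply: (le_trans (ler_normB _ _)).
have := Gd r r0 rd; rewrite normrM (ger0_norm r0).
have : r * `|G 1 - G 0| <= r * c by rewrite ler_wpM2l// lerDl.
lra.
Qed.

(** * Expansion of multiaffine functions on the nonnegative orthant *)

Section Multiaffine.
Variables (R : realType) (n : nat).
Notation V := 'rV[R]_n.
Implicit Types (l : V) (F : V -> R) (A I J : {set 'I_n}).

Definition upd l i (t : R) : V := \row_j if j == i then t else l 0 j.
Definition indic_row A : V := \row_j (j \in A)%:R.
Definition nonneg l := forall i, 0 <= l 0 i.

(* The coefficient of prod_(i in I) l_i in the expansion of a multiaffine F. *)
Definition mobius F I : R :=
  \sum_(J : {set 'I_n} | J \subset I) (-1) ^+ #|I :\: J| * F (indic_row J).

Definition multiaffine F := forall l i t, nonneg l -> 0 <= t ->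
  F (upd l i t) = F (upd l i 0) + t * (F (upd l i 1) - F (upd l i 0)).

Lemma upd_id l i : upd l i (l 0 i) = l.
Proof. by apply/rowP => j; rewrite mxE; case: eqP => [->|]. Qed.

Lemma upd_upd l i s t : upd (upd l i s) i t = upd l i t.
Proof. by apply/rowP => j; rewrite !mxE; case: eqP. Qed.

Lemma upd_comm l i j s t : i != j -> upd (upd l i s) j t = upd (upd l j t) i s.
Proof.
move=> ij; apply/rowP => k; rewrite !mxE.
by case: (eqVneq k j) => [->|//]; rewrite eq_sym (negbTE ij).
Qed.

Lemma nonneg_upd l i t : nonneg l -> 0 <= t -> nonneg (upd l i t).
Proof. by move=> l0 t0 j; rewrite mxE; case: ifP. Qed.

Lemma nonneg_indic A : nonneg (indic_row A).
Proof. by move=> i; rewrite mxE. Qed.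

Lemma sum_subsetU1 (g : {set 'I_n} -> R) a A : a \notin A ->
  \sum_(I : {set 'I_n} | I \subset a |: A) g I =
  \sum_(I : {set 'I_n} | I \subset A) g I + \sum_(I : {set 'I_n} | I \subset A) g (a |: I).
Proof.
move=> aA; rewrite (bigID (fun I : {set 'I_n} => a \in I))/= addrC; congr (_ + _).
  apply: eq_bigl => I; apply/andP/idP => [[IaA aI]|IA].
    apply/fintype.subsetP => i iI; have := fintype.subsetP IaA i iI.
    rewrite !inE => /orP[/eqP ia|//].
    by rewrite -ia iI in aI.
  split; first exact: fintype.subset_trans (finset.subsetUr _ _).
  by apply: contra aA; exact: (fintype.subsetP IA).
rewrite (reindex_onto (fun I => a |: I) (fun I => I :\ a)) /=; last first.
  by move=> I /andP[_ aI]; rewrite finset.setD1K.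
apply: eq_bigl => I; apply/andP/idP => [[/andP[IaA _] /eqP IE]|IA].
  have aI : a \notin I by rewrite -IE !inE eqxx.
  apply/fintype.subsetP => i iI; have := fintype.subsetP IaA i; rewrite !inE iI orbT => /(_ isT).
  by case/orP => // /eqP ia; rewrite -ia iI in aI.
have aI : a \notin I by apply: contra aA; exact: (fintype.subsetP IA).
by rewrite finset.setUS// finset.setU11 finset.setU1K.
Qed.

(** Induction on the size of A: for a in A, F l = F l' + l_a F1 l', where l' has a-th entry 0 and F1
    is the increment of F in variable a. F1 is again multiaffine, and its coefficient at I is that
    of F at [a |: I]. *)
Lemma multiaffine_expansion F A l : multiaffine F -> nonneg l ->
  (forall i, i \notin A -> l 0 i = 0) ->
  F l = \sum_(I : {set 'I_n} | I \subset A) (\prod_(i in I) l 0 i) * mobius F I.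
Proof.
have [m] := ubnP #|A|; elim: m A F l => // m IH A F l Am aF l0 lA.
have [A0|[a aA]] := finset.set_0Vmem A.
  rewrite A0 (big_pred1 finset.set0) => [|I]; last by rewrite finset.subset0.
  rewrite big_set0 mul1r /mobius (big_pred1 finset.set0) => [|I]; last by rewrite finset.subset0.
  rewrite finset.setD0 cards0 expr0 mul1r; congr F; apply/rowP => i.
  by rewrite mxE inE lA// A0 inE.
pose A' := A :\ a.
have aA' : a \notin A' by rewrite !inE eqxx.
have AE : A = a |: A' by rewrite finset.setD1K.
pose F1 x := F (upd x a 1) - F (upd x a 0).
have aF1 : multiaffine F1.
  move=> x i t x0 t0; rewrite /F1; case: (eqVneq i a) => [->|ia].
    by rewrite !upd_upd subrr mulr0 addr0.
  rewrite !(upd_comm _ _ _ ia).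
  rewrite (aF (upd x a 1) i t)// ?(aF (upd x a 0) i t)//; first ring.
    exact: nonneg_upd.
  exact: nonneg_upd.
have mob1 I : I \subset A' -> mobius F (a |: I) = mobius F1 I.
  move=> IA'; have aI : a \notin I by apply: contra aA'; exact: (fintype.subsetP IA').
  rewrite /mobius sum_subsetU1// -big_split/=; apply: eq_bigr => J JI.
  have aJ : a \notin J by apply: contra aI; exact: (fintype.subsetP JI).
  have -> : (a |: I) :\: J = a |: (I :\: J).
    apply/finset.setP => i; rewrite !inE; case: (eqVneq i a) => [->|//]; by rewrite aJ.
  have -> : (a |: I) :\: (a |: J) = I :\: J.
    apply/finset.setP => i; rewrite !inE; case: (eqVneq i a) => [->|//].
    by rewrite (negbTE aI) andbF.
  rewrite cardsU1 !inE (negbTE aI) andbF/= add1n exprS /F1.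
  have -> : upd (indic_row J) a 1 = indic_row (a |: J).
    by apply/rowP => i; rewrite !mxE !inE; case: eqP.
  have -> : upd (indic_row J) a 0 = indic_row J.
    by apply/rowP => i; rewrite !mxE; case: eqP => // ->; rewrite (negbTE aJ).
  by ring.
pose l' := upd l a 0.
have l'0 : nonneg l' by exact: nonneg_upd.
have l'A i : i \notin A' -> l' 0 i = 0.
  by rewrite !inE negb_and negbK mxE; case: eqP => //= _; exact: lA.
have cA' : (#|A'| < m)%N by move: Am; rewrite AE cardsU1 aA'.
have prodl' I : I \subset A' -> \prod_(i in I) l' 0 i = \prod_(i in I) l 0 i.
  move=> IA'; apply: eq_bigr => i iI; rewrite mxE; case: eqP => // ia.
  by rewrite ia in iI; rewrite (fintype.subsetP IA' _ iI) in aA'.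
have F1l' : F (upd l a 1) - F l' = \sum_(I : {set 'I_n} | I \subset A')
    (\prod_(i in I) l' 0 i) * mobius F1 I.
  by rewrite -IH// /F1 !upd_upd.
rewrite -{1}(upd_id l a) aF// -/l' F1l' AE sum_subsetU1// (IH A' F l')//.
congr (_ + _); first by apply: eq_bigr => I /prodl' ->.
rewrite mulr_sumr; apply: eq_bigr => I IA'.
rewrite prodl'// mob1// big_setU1/= ?mulrA//.
by apply: contra aA'; exact: (fintype.subsetP IA').
Qed.

End Multiaffine.

(** * Support functions of the images of parallelepipeds *)

Section Valuation.
Variables (R : realType) (n : nat) (Phi : set 'rV[R]_n -> set 'rV[R]_n).
Notation V := 'rV[R]_n.
Implicit Types (l u : V) (W : 'M[R]_n) (I J : {set 'I_n}).

Definition para W l : set V := affine_image W 0 (box 0 l).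
Definition hpara W u l : R := supp (Phi (para W l)) u.

Lemma body_para W l : nonneg l -> convex_body (para W l).
Proof. by move=> l0; apply: body_affine_box => i; rewrite mxE. Qed.

Hypotheses (valPhi : minkowski_valuation Phi) (contPhi : hcontinuous Phi)
  (invPhi : translation_invariant Phi).

Lemma body_Phi_para W l : nonneg l -> convex_body (Phi (para W l)).
Proof. by move=> l0; apply: valPhi.1; exact: body_para. Qed.

Lemma supp_Phi_near K u e : convex_body K -> 0 < e ->
  exists2 d : R, 0 < d & forall L, convex_body L -> forall r, 0 <= r -> r < d ->
    hclose r K L -> `|supp (Phi L) u - supp (Phi K) u| < e.
Proof.
move=> bK e0; pose c := \sum_i `|u 0 i| + 1.
have c0 : 0 < c by rewrite ltr_wpDl// sumr_ge0.
have [d d0 Pd] := contPhi bK (divr_gt0 e0 c0).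
exists d => // L bL r r0 rd rKL.
have := supp_hausdorff u (valPhi.1 _ bK) (valPhi.1 _ bL) (Pd L bL (hausdorff_lt r0 rd rKL)).
rewrite distrC => /le_lt_trans; apply.
by rewrite mulrAC ltr_pdivrMr// ltr_pM2l// ltrDl.
Qed.

(** A cut at height r splits the body with i-th edge r + s into the one with edge r and a translate
    of the one with edge s, meeting in a translate of the one with edge 0. The valuation property
    then gives the equation of [cauchy_affine]. *)
Lemma hpara_multiaffine W u : W \in unitmx -> multiaffine (hpara W u).
Proof.
move=> Wu l i t l0 t0.
apply: (@cauchy_affine _ (fun s => hpara W u (upd l i s))) => // [r s r0 s0|e e0].
  pose P x := para W (upd l i x).
  have nn x : 0 <= x -> nonneg (upd l i x) by move=> x0; exact: nonneg_upd.
  pose Q := affine_image W 0 (box (upd 0 i r) (upd l i (r + s))).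
  pose S := affine_image W 0 (box (upd 0 i r) (upd l i r)).
  have shift x : translate (P x) (r *: row i W) =
      affine_image W 0 (box (upd 0 i r) (upd l i (r + x))).
    have e : r *: row i W = (r *: delta_mx 0 i) *m W by rewrite -scalemxAl -rowE.
    apply/seteqP; split=> [_ [_ [y yb <-] <-]|_ [y yb <-]].
      exists (y + r *: delta_mx 0 i); last by rewrite mulmxDl e addr0 addr0.
      move=> j; have := yb j; rewrite !mxE eqxx; case: eqP => _ /=.
        by rewrite mulr1 => /andP[? ?]; apply/andP; lra.
      by rewrite mulr0 addr0.
    exists ((y - r *: delta_mx 0 i) *m W + 0).
      exists (y - r *: delta_mx 0 i) => //.
      move=> j; have := yb j; rewrite !mxE eqxx; case: eqP => _ /=.
        by rewrite mulr1 => /andP[? ?]; apply/andP; lra.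
      by rewrite mulr0 subr0.
    by rewrite !addr0 e -mulmxDl subrK.
  have bP x : 0 <= x -> convex_body (P x) by move=> /nn; exact: body_para.
  have bQ x : 0 <= x -> convex_body (affine_image W 0 (box (upd 0 i r) (upd l i (r + x)))).
    move=> x0; apply: body_affine_box => j; rewrite !mxE; case: eqP => _; last exact: l0.
    by rewrite lerDl.
  (* W is invertible, so intersecting the images amounts to intersecting the boxes. *)
  have injW : injective (fun x : V => x *m W + 0).
    by move=> x y /addIr/(congr1 (mulmx^~ (invmx W))); rewrite !mulmxK.
  have union : P r `|` Q = P (r + s).
    apply/seteqP; split=> [_ [[y yb <-]|[y yb <-]]|_ [y yb <-]].
    - exists y => // j; have := yb j; rewrite !mxE; case: eqP => // _ /andP[? ?].
      by apply/andP; lra.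
    - exists y => // j; have := yb j; rewrite !mxE; case: eqP => // _ /andP[? ?].
      by apply/andP; lra.
    - have [yr|yr] := leP (y 0 i) r.
        left; exists y => // j; have := yb j; rewrite !mxE; case: eqP => // -> /andP[-> _].
        by rewrite yr.
      right; exists y => // j; have := yb j; rewrite !mxE; case: eqP => // -> /andP[_ ->].
      by rewrite ltW.
  have inter : P r `&` Q = S.
    apply/seteqP; split=> [_ [[y yb <-] [z zb]] /injW zy|_ [y yb <-]].
      exists y => // j; have := yb j; have := zb j; rewrite zy !mxE; case: eqP => // _.
      by move=> /andP[-> _] /andP[_ ->].
    split; exists y => // j; have := yb j; rewrite !mxE; case: eqP => // _ /andP[? ?];
      by apply/andP; lra.
  have bPr := bP r r0; have bPrs := bP (r + s) (addr_ge0 r0 s0).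
  have := valPhi.2 (P r) Q bPr (bQ s s0); rewrite union inter => /(_ bPrs).
  have -> : Q = translate (P s) (r *: row i W) by rewrite shift.
  have -> : S = translate (P 0) (r *: row i W) by rewrite shift addr0.
  rewrite !invPhi//; [|exact: bP|exact: bP] => /(congr1 (fun K => supp K u)).
  have [b1 b2 b3 b4] : [/\ convex_body (Phi (P r)), convex_body (Phi (P s)),
      convex_body (Phi (P (r + s))) & convex_body (Phi (P 0))].
    by split; apply: valPhi.1; apply: bP => //; rewrite addr_ge0.
  by rewrite !supp_msum.
have nn x : 0 <= x -> nonneg (upd l i x) by move=> x0; exact: nonneg_upd.
have [d d0 Pd] := supp_Phi_near u (body_para W (nn 0 (lexx 0))) e0.
(* Collapsing the i-th edge moves points by at most s times the length of w_i; adding 1 makes w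
   positive. *)
pose w := edist (row i W) 0 + 1.
have w0 : 0 < w by rewrite ltr_wpDl// euclidean_dist_ge0.
exists (d / w) => [|s s0 sd]; first exact: divr_gt0.
apply: (Pd _ (body_para W (nn s s0)) (s * w)); first by rewrite mulr_ge0// ltW.
  by rewrite -ltr_pdivlMr.
have close (y z : V) (r : R) : 0 <= r -> r <= s -> z = y + r *: row i W -> edist y z <= s * w.
  move=> r0 rs ->; rewrite edist_shift ger0_norm// ler_pM// ?euclidean_dist_ge0//.
  by rewrite lerDl.
split=> [_ [y yb <-]|_ [y yb <-]].
  exists (y *m W + 0).
    exists y => // j; have := yb j; rewrite !mxE; case: eqP => // _ /andP[-> /le_trans]; exact.
  by apply: (close _ _ 0) => //; rewrite scale0r !addr0.
exists (upd y i 0 *m W + 0).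
  by exists (upd y i 0) => // j; have := yb j; rewrite !mxE; case: eqP => //; rewrite lexx.
have := yb i; rewrite !mxE eqxx => /andP[y0 ys].
apply: (close _ _ (y 0 i)) => //.
rewrite !addr0 rowE scalemxAl -mulmxDl; congr (_ *m _); apply/rowP => j; rewrite !mxE eqxx/=.
by case: eqP => [->|_]; [rewrite mulr1 add0r|rewrite mulr0 addr0].
Qed.

End Valuation.

(** * Coefficient bodies *)

Lemma le_of_close (R : realType) (a b k c e : R) :
  a - b < e / 2 -> b <= k + c -> c < e / 2 -> a <= e + k.
Proof. by lra. Qed.

Section Coefficients.
Variables (R : realType) (n : nat) (Phi : set 'rV[R]_n -> set 'rV[R]_n).
Notation V := 'rV[R]_n.
Implicit Types (l u v : V) (W : 'M[R]_n) (I J : {set 'I_n}).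

(** The function f_I of the expansion over subsets. *)
Definition coeff W I u : R := mobius (hpara Phi W u) I.
(** L_I as an intersection of half-spaces; that each of them touches L_I, so that f_I is a support
    function, is [coeff_body_attained]. *)
Definition coeff_body W I (x : V) : Prop := forall u, dot x u <= coeff W I u.
Definition coeff_diff W I (v : V) : Prop :=
  exists x y, [/\ coeff_body W I x, coeff_body W I y & v = y - x].

Hypotheses (valPhi : minkowski_valuation Phi) (contPhi : hcontinuous Phi)
  (invPhi : translation_invariant Phi).

Lemma hpara_expansion W u l : W \in unitmx -> nonneg l ->
  hpara Phi W u l = \sum_(I : {set 'I_n}) (\prod_(i in I) l 0 i) * coeff W I u.
Proof.
move=> Wu l0; rewrite (multiaffine_expansion (A := [set: 'I_n]%SET))//.
- by apply: eq_bigl => I; rewrite finset.subsetT.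
- exact: hpara_multiaffine.
- by move=> i; rewrite inE.
Qed.

(** At N+1 times the indicator of I only subsets of I contribute; after division by (N+1)^|I| every
    proper one carries a factor at most 1/(N+1). *)
Lemma hpara_scaled W I u (N : nat) : W \in unitmx ->
  `|hpara Phi W u (N.+1%:R *: indic_row R I) / N.+1%:R ^+ #|I| - coeff W I u| <=
    (\sum_(J : {set 'I_n}) `|coeff W J u|) / N.+1%:R.
Proof.
move=> Wu; set q : R := N.+1%:R.
have q0 : 0 < q by rewrite ltr0n.
have q1 : 1 <= q by rewrite ler1n.
have nn : nonneg (q *: indic_row R I) by move=> i; rewrite !mxE mulr_ge0.
rewrite (multiaffine_expansion (A := I) (hpara_multiaffine valPhi contPhi invPhi _ Wu))//;
  last first.
  by move=> i iI; rewrite !mxE (negbTE iI) mulr0.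
rewrite (bigD1 I)//= -/(coeff W I u).
have prodE J : J \subset I -> \prod_(i in J) (q *: indic_row R I) 0 i = q ^+ #|J|.
  move=> JI; rewrite -prodr_const; apply: eq_bigr => i iJ.
  by rewrite !mxE (fintype.subsetP JI _ iJ) mulr1.
rewrite prodE// mulrDl mulrAC divff ?mul1r; last by rewrite expf_neq0// gt_eqF.
rewrite addrAC subrr add0r !mulr_suml.
apply: (le_trans (ler_norm_sum _ _ _)).
rewrite [leRHS](bigID (fun J => (J \subset I) && (J != I)))/=.
apply: ler_wpDr.
  by apply: sumr_ge0 => J _; rewrite divr_ge0// ltW.
apply: ler_sum => J /andP[JI JnI].
have JI' : (#|J| < #|I|)%N by apply: proper_card; rewrite finset.properEneq JnI.
rewrite prodE// -/(coeff W J u) mulrAC normrM mulrC ler_wpM2l//.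
rewrite ger0_norm; last by rewrite divr_ge0// exprn_ge0// ltW.
rewrite ler_pdivrMr ?exprn_gt0// mulrC ler_pdivlMr//.
by rewrite -exprSr ler_weXn2l.
Qed.

(* a cluster point of boundary points of the rescaled bodies Phi (N P_I) / N^|I| *)
Lemma coeff_body_attained W I u : W \in unitmx ->
  exists2 x, coeff_body W I x & dot x u = coeff W I u.
Proof.
move=> Wu.
have nn (N : nat) : nonneg (N.+1%:R *: indic_row R I) by move=> i; rewrite !mxE mulr_ge0.
have bP N := body_Phi_para valPhi W (nn N).
have [y yP] : {y : nat -> V & forall N, Phi (para W (N.+1%:R *: indic_row R I)) (y N) /\
    dot (y N) u = hpara Phi W u (N.+1%:R *: indic_row R I)}.
  apply: (@choice _ _ (fun N y => Phi (para W (N.+1%:R *: indic_row R I)) y /\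
    dot y u = hpara Phi W u (N.+1%:R *: indic_row R I))) => N.
  by have [x [? ? _]] := supp_attained u (bP N); exists x.
pose z N := (N.+1%:R ^+ #|I|)^-1 *: y N.
pose C u := \sum_(J : {set 'I_n}) `|coeff W J u|.
have qpos N : 0 < N.+1%:R ^+ #|I| :> R by rewrite exprn_gt0.
have z_le v N : dot (z N) v <= coeff W I v + C v / N.+1%:R.
  have := hpara_scaled I v N Wu; rewrite ler_norml => /andP[_].
  rewrite lerBlDr addrC; apply: le_trans.
  rewrite /z dotZl mulrC ler_pM2r ?invr_gt0//.
  exact: dot_le_supp (bP N) (yP N).1.
have z_ge N : coeff W I u - C u / N.+1%:R <= dot (z N) u.
  have := hpara_scaled I u N Wu; rewrite ler_norml => /andP[+ _].
  have -> : dot (z N) u = hpara Phi W u (N.+1%:R *: indic_row R I) / N.+1%:R ^+ #|I|.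
    by rewrite /z dotZl (yP N).2 mulrC.
  by rewrite lerBrDr addrC.
have C0 v : 0 <= C v by exact: sumr_ge0.
have CN v N : C v / N.+1%:R <= C v.
  by rewrite ler_pdivrMr// ler_peMr// ler1n.
(* Bounds along plus and minus the basis vectors confine all [z N] to one compact box. *)
pose M : V := \row_i (`|coeff W I (delta_mx 0 i)| + C (delta_mx 0 i) +
   (`|coeff W I (- delta_mx 0 i)| + C (- delta_mx 0 i))).
have zM N : box (- M) M (z N).
  move=> i; rewrite [(- M) 0 i]mxE -ler_norml [M 0 i]mxE ler_norml.
  have h1 := le_trans (z_le (- delta_mx 0 i) N) (lerD (lexx _) (CN _ _)).
  have h2 := le_trans (z_le (delta_mx 0 i) N) (lerD (lexx _) (CN _ _)).
  move: h1 h2; rewrite dotNr dot_delta => h1 h2.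
  have nC w : 0 <= `|coeff W I w| + C w by rewrite addr_ge0.
  have leC w : coeff W I w + C w <= `|coeff W I w| + C w by rewrite lerD2r ler_norm.
  apply/andP; split.
    by rewrite lerNl (le_trans h1)// (le_trans (leC _))// lerDr.
  by rewrite (le_trans h2)// (le_trans (leC _))// lerDl.
have [|x [_ clx]] := @compact_box R n (- M) M (z @ \oo) _.
  by exists 0%N => // N _; exact: zM.
have near_x v e : 0 < e -> exists N, [/\ `|dot x v - dot (z N) v| < e & C v / N.+1%:R < e].
  move=> e0.
  have := @continuous_dot R n v x => /cvgrPdist_lt /(_ e e0) nx.
  (* From this index on, the error [C v / N.+1%:R] is below e. *)
  pose N0 := Num.truncn (C v / e).
  have tail : (z @ \oo) [set z N | N in [set N | (N0 <= N)%N]].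
    by exists N0 => // N /= N0N; exists N.
  have [_ [[N /= N0N <-] zx]] := clx _ _ tail nx.
  exists N; split=> //.
  rewrite ltr_pdivrMr// mulrC -ltr_pdivrMr//.
  by apply: (lt_le_trans (truncnS_gt _)); rewrite ler_nat.
have half e : 0 < e -> 0 < e / 2 :> R by move=> e0; rewrite divr_gt0.
have x_le v : dot x v <= coeff W I v.
  apply/ler_addgt0Pl => e /half e0; have [N []] := near_x v _ e0.
  rewrite ltr_norml => /andP[_ h1] h2; exact: le_of_close h1 (z_le v N) h2.
exists x => //; apply/eqP; rewrite eq_le x_le/=.
apply/ler_addgt0Pl => e /half e0; have [N []] := near_x u _ e0.
rewrite distrC ltr_norml => /andP[_ h1] h2.
have := z_ge N; rewrite lerBlDr => h3; rewrite addrC.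
move: h1; rewrite ltrBlDr => /ltW/(lerD (lexx (C u / N.+1%:R))) h1.
rewrite addrC in h3; apply: (le_trans h3); apply: (le_trans h1).
by rewrite addrA [leRHS]addrC {2}(splitr e) !lerD2r ltW.
Qed.

(** By the expansion the point satisfies every support inequality of Phi (P l); so Phi (P l)
    contains the Minkowski sum of the scaled L_I. *)
Lemma sum_coeff_body W l (x : {set 'I_n} -> V) : W \in unitmx -> nonneg l ->
  (forall I, coeff_body W I (x I)) ->
  Phi (para W l) (\sum_(I : {set 'I_n}) (\prod_(i in I) l 0 i) *: x I).
Proof.
move=> Wu l0 xI; apply: mem_body; first exact: body_Phi_para.
move=> u; rewrite -/(hpara Phi W u l) hpara_expansion// dot_suml.
apply: ler_sum => I _; rewrite dotZl ler_wpM2l//; last exact: xI.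
by apply: prodr_ge0.
Qed.

(** The right-hand side is the width of L_I in direction u. *)
Lemma coeff_diff_width W I v u : coeff_diff W I v ->
  `|dot v u| <= coeff W I u + coeff W I (- u).
Proof.
move=> [x [y [xI yI ->]]]; rewrite dotBl.
have := (xI u, xI (- u), yI u, yI (- u)); rewrite !dotNr => -[[[? ?] ?] ?].
by rewrite ler_norml; lra.
Qed.

Lemma coeff_diff_exists W I u : W \in unitmx ->
  exists2 v, coeff_diff W I v & dot v u = coeff W I u + coeff W I (- u).
Proof.
move=> Wu; have [y yI yu] := coeff_body_attained I u Wu.
have [x xI xu] := coeff_body_attained I (- u) Wu.
exists (y - x); first by exists x, y.
by rewrite dotBl yu -xu dotNr.
Qed.

(** * Consequences of the volume condition *)

Hypothesis (n0 : (0 < n)%N) (vcPhi : VC Phi).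

Lemma volume_para_le W : exists2 B : R, 0 < B & forall l, nonneg l ->
  (volume (para W l) <= (B * \prod_i l 0 i)%:E)%E.
Proof.
have [B B0 leB] := volume_affine_box W n0; exists B => // l l0.
apply: (le_trans (leB 0 0 l)); rewrite lee_fin ler_pM2l//.
by apply: ler_prod => i _; rewrite mxE subr0 max_l// lexx l0.
Qed.

(** Otherwise every L_I has width 0 along u, so the image of the unit parallelepiped lies in a
    hyperplane and has volume 0, against the lower bound in (VC). *)
Lemma coeff_diff_span W u : W \in unitmx -> u != 0 ->
  exists I v, coeff_diff W I v /\ dot v u != 0.
Proof.
move=> Wu u0; apply: contrapT => noI.
have width0 I : coeff W I u + coeff W I (- u) = 0.
  have [v vI <-] := coeff_diff_exists I u Wu.
  by apply: contrapT => /eqP vu; apply: noI; exists I, v.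
pose K := Phi (para W (const_mx 1)).
have nn1 : nonneg (const_mx 1 : V) by move=> i; rewrite mxE.
have bK : convex_body K by exact: body_Phi_para.
have KE w : supp K w = \sum_(I : {set 'I_n}) coeff W I w.
  rewrite -/(hpara Phi W w (const_mx 1)) hpara_expansion//; apply: eq_bigr => I _.
  by rewrite big1 ?mul1r// => i _; rewrite mxE.
have flat x : K x -> \sum_i x 0 i * u 0 i = supp K u.
  move=> Kx; apply/eqP; rewrite eq_le (dot_le_supp u bK Kx)/=.
  have := dot_le_supp (- u) bK Kx; rewrite dotNr.
  have -> : supp K (- u) = - supp K u.
    apply/eqP; rewrite -addr_eq0 addrC !KE -big_split/= big1//.
  by rewrite lerN2.
have [M M0 KM] := body_bounded bK.
have vol0 : volume K = 0%E.
  apply: (volume_hyperplane n0 u0 _ flat); exists (const_mx (- M)), (const_mx M).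
  by move=> x Kx i; rewrite !mxE -ler_norml KM.
have [c [C [c0 _ vc]]] := vcPhi.
have /andP[+ _] := vc _ (body_para W nn1); rewrite -/K vol0.
have [B B0 leB] := volume_parallelepiped_ge n0 Wu.
have := leB 0 (const_mx 1) nn1; rewrite big1 ?mulr1 => [|i _]; last by rewrite mxE.
move=> Ble; apply/negP; rewrite -ltNge; apply: lt_le_trans (lee_wpmul2l _ Ble).
  by rewrite -EFinM lte_fin mulr_gt0.
by rewrite lee_fin ltW.
Qed.

(** Averaging points of the n segments of K that run along the rows of T gives a parallelepiped in K
    with edges t_i / n times these rows, whence the factor n^-n. *)
Lemma volume_body_ge (T : 'M[R]_n) : T \in unitmx -> exists2 B : R, 0 < B &
  forall K (p : 'I_n -> V) (t : 'I_n -> R), convex_body K ->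
    (forall i, 0 <= t i) -> (forall i, K (p i) /\ K (p i + t i *: row i T)) ->
    ((B * \prod_i t i)%:E <= volume K)%E.
Proof.
move=> Tu; have [B B0 leB] := volume_parallelepiped_ge n0 Tu.
have nR : 0 < n%:R :> R by rewrite ltr0n.
exists (B / n%:R ^+ n); first by rewrite divr_gt0 ?exprn_gt0.
move=> K p t bK t0 pK.
pose s : V := \row_i (t i / n%:R).
have s0 i : 0 <= s 0 i by rewrite mxE divr_ge0.
pose c := \sum_i n%:R^-1 *: p i.
have -> : B / n%:R ^+ n * \prod_i t i = B * \prod_i s 0 i.
  under [in RHS]eq_bigr do rewrite mxE.
  by rewrite big_split/= prodr_const card_ord exprVn mulrA mulrAC.
apply: (le_trans (leB c s s0)); apply: le_volume => _ [x xs <-].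
have q i : K (p i + (n%:R * x 0 i) *: row i T).
  have /andP[x0 xs'] := xs i; rewrite mxE in x0; rewrite mxE ler_pdivlMr// mulrC in xs'.
  have [ti0|ti0] := eqVneq (t i) 0.
    have -> : n%:R * x 0 i = 0.
      by apply/le_anti/andP; split; [rewrite -ti0|exact: mulr_ge0 (ltW nR) x0].
    by rewrite scale0r addr0; exact: (pK i).1.
  have tp : 0 < t i by rewrite lt_neqAle eq_sym ti0 t0.
  have r0 : 0 <= n%:R * x 0 i / t i by rewrite divr_ge0// mulr_ge0// ltW.
  have r1 : n%:R * x 0 i / t i <= 1 by rewrite ler_pdivrMr// mul1r.
  have := bK.2.2 _ _ _ (pK i).1 (pK i).2 r0 r1.
  by rewrite scalerDr addrA -scalerDl subrK scale1r scalerA divfK.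
apply: mem_body => // u.
have -> : x *m T + c = \sum_i n%:R^-1 *: (p i + (n%:R * x 0 i) *: row i T).
  rewrite addrC /c mulmx_sum_row -big_split/=; apply: eq_bigr => i _.
  by rewrite scalerDr scalerA mulKf ?gt_eqF.
rewrite dot_suml; apply: (@le_trans _ _ (\sum_(i < n) n%:R^-1 * supp K u)).
  by apply: ler_sum => i _; rewrite dotZl ler_pM2l ?invr_gt0// dot_le_supp.
by rewrite -mulr_suml sumr_const card_ord -[X in X * _]mulr_natr mulVf ?mul1r// gt_eqF.
Qed.

(** Small t excludes a = 0 and large t excludes a >= 2. *)
Lemma exponent_eq1 (k C : R) (a : nat) : 0 < k -> 0 < C ->
  (forall t, 0 < t -> k * t ^+ a <= C * t) -> a = 1%N.
Proof.
move=> k0 C0 le_t; case: a le_t => [|[|a]] // le_t.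
  (* This t makes the right side k / 2, below the left side k. *)
  have := le_t (k / (2 * C)); rewrite divr_gt0 ?mulr_gt0// expr0 mulr1 => /(_ isT).
  have -> : C * (k / (2 * C)) = k / 2 by field; rewrite gt_eqF.
  by move=> ?; exfalso; lra.
(* Here k t = C + k exceeds C, while the hypothesis divided by t bounds k t^(a+1) by C. *)
pose t := C / k + 1.
have t1 : 1 <= t by rewrite lerDr divr_ge0// ltW.
have t0 : 0 < t by exact: lt_le_trans t1.
have := le_t t t0; rewrite exprS mulrCA mulrC ler_pM2r//.
have ta : t <= t ^+ a.+1 by rewrite exprS ler_peMr ?exprn_ege1// ltW.
have kt : k * t = C + k by rewrite /t mulrDr mulrCA divff ?mulr1// gt_eqF.
have : k * t <= k * t ^+ a.+1 by rewrite ler_pM2l.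
by move=> ? ?; exfalso; lra.
Qed.

(* Phi (P(1,..,t,..,1)) contains a parallelepiped with edges t^[m \in I i] (row i T) *)
Lemma coeff_diff_balanced W (T : 'M[R]_n) (I : 'I_n -> {set 'I_n}) :
  W \in unitmx -> T \in unitmx -> (forall i, coeff_diff W (I i) (row i T)) ->
  forall m, #|[set i | m \in I i]%SET| = 1%N.
Proof.
move=> Wu Tu DI m.
have [z zJ] : {z : {set 'I_n} -> V & forall J, coeff_body W J (z J)}.
  by apply: choice => J; have [x xJ _] := coeff_body_attained J 0 Wu; exists x.
have [B B0 leB] := volume_body_ge Tu.
have [B' B'0 leB'] := volume_para_le W.
have [c [C [c0 C0 vc]]] := vcPhi.
apply: (@exponent_eq1 B (C * B')) => //; first by rewrite mulr_gt0.
move=> t t0.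
pose l : V := upd (const_mx 1) m t.
have l0 : nonneg l by move=> i; rewrite !mxE; case: ifP => // _; rewrite ltW.
have prodl (J : {set 'I_n}) : \prod_(i in J) l 0 i = if m \in J then t else 1.
  case: ifP => mJ.
    rewrite (bigD1 m)//= mxE eqxx big1 ?mulr1// => i /andP[_ im].
    by rewrite !mxE (negbTE im).
  rewrite big1// => i iJ; rewrite !mxE; case: eqP => // im.
  by rewrite -im iJ in mJ.
have [] : exists p : 'I_n -> V, forall i, Phi (para W l) (p i) /\
    Phi (para W l) (p i + (if m \in I i then t else 1) *: row i T).
  suff [p pP] : {p : 'I_n -> V & forall i, Phi (para W l) (p i) /\
    Phi (para W l) (p i + (if m \in I i then t else 1) *: row i T)} by exists p.
  apply: (@choice _ _ (fun i p => Phi (para W l) p /\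
    Phi (para W l) (p + (if m \in I i then t else 1) *: row i T))) => i.
  have [x [y [xI yI Tv]]] := DI i.
  (* The two points differ only in the summand of [I i], hence by [row i T] times the product of the
     l_j over that set. *)
  pose sel w J := if J == I i then w else z J.
  have selP w : coeff_body W (I i) w -> forall J, coeff_body W J (sel w J).
    by move=> wI J; rewrite /sel; case: eqP => [->|].
  exists (\sum_(J : {set 'I_n}) (\prod_(j in J) l 0 j) *: sel x J).
  split; first by apply: sum_coeff_body => //; exact: selP.
  have := sum_coeff_body Wu l0 (selP y yI).
  congr (Phi (para W l) _).
  rewrite (bigD1 (I i))//= [in RHS](bigD1 (I i))//= Tv /sel eqxx prodl.
  rewrite scalerBr addrAC [X in _ = X + _]addrC subrK; congr (_ + _).
  by apply: eq_bigr => J /negbTE ->.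
move=> p pP.
have := leB _ p (fun i => if m \in I i then t else 1) (body_Phi_para valPhi W l0).
move=> /(_ _ pP) h1.
have /andP[_ h2] := vc _ (body_para W l0).
have h3 := leB' l l0.
have pl : \prod_i l 0 i = t.
  by have := prodl [set: 'I_n]%SET; rewrite inE => <-; apply: eq_bigl => i; rewrite inE.
have pt : \prod_i (if m \in I i then t else 1) = t ^+ #|[set i | m \in I i]%SET|.
  rewrite -prodr_const big_mkcond/= [RHS]big_mkcond/=; apply: eq_bigr => i _.
  by rewrite inE.
rewrite -lee_fin -pt -mulrA -{2}pl.
apply: le_trans (h1 _) _; first by move=> i; case: ifP => // _; exact: ltW.
apply: le_trans h2 _; rewrite EFinM; apply: lee_wpmul2l => //.
by rewrite lee_fin ltW.
Qed.

End Coefficients.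

(** * Change of basis *)

(** The permutation reindexes the alternating sum and preserves cardinals; only indicators of
    subsets of I enter it. *)
Lemma mobius_perm (R : realType) (n : nat) (F G : 'rV[R]_n -> R) (s : {perm 'I_n})
    (I : {set 'I_n}) :
  (forall J : {set 'I_n}, J \subset I -> F (indic_row R J) = G (indic_row R (s @: J)%SET)) ->
  mobius F I = mobius G (s @: I)%SET.
Proof.
move=> FG; have injs := @perm_inj _ s.
rewrite /mobius [RHS](reindex_inj (imset_inj injs))/=.
have subE (J : {set 'I_n}) : (s @: J \subset s @: I)%SET = (J \subset I).
  apply/idP/idP => [/fintype.subsetP sJI|]; last exact: imsetS.
  apply/fintype.subsetP => i iJ; rewrite -(mem_imset _ _ injs); apply: sJI.
  by rewrite mem_imset.
apply: eq_big => [J|J JI]; first by rewrite subE.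
by rewrite FG// !cardsDS ?subE// !card_imset.
Qed.

Section Shear.
Variables (R : realType) (n : nat) (Phi : set 'rV[R]_n -> set 'rV[R]_n).
Notation V := 'rV[R]_n.
Implicit Types (l u v : V) (W : 'M[R]_n) (I J : {set 'I_n}).
Hypotheses (valPhi : minkowski_valuation Phi) (contPhi : hcontinuous Phi).

(** The basis with w_a replaced by w_a + e w_b, which tends to W as e tends to 0. *)
Definition shear W (a b : 'I_n) (e : R) : 'M[R]_n := W + e *: (delta_mx a b *m W).

Lemma mul_row_delta (x : V) (a b : 'I_n) : x *m delta_mx a b = x 0 a *: delta_mx 0 b.
Proof.
apply/rowP => j; rewrite !mxE (bigD1 a)//= !mxE eqxx big1 ?addr0// => i ia.
by rewrite !mxE (negbTE ia) mulr0.
Qed.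

Lemma mul_shear W a b e (x : V) : x *m shear W a b e = (x + (e * x 0 a) *: delta_mx 0 b) *m W.
Proof.
by rewrite mulmxDr mulmxDl -scalemxAr mulmxA mul_row_delta -!scalemxAl scalerA.
Qed.

(** Points of each parallelepiped move by at most |e| times the length of w_b, so continuity of Phi
    passes to the finite alternating sum. Two directions are treated at once because a width
    involves u and -u. *)
Lemma coeff_shear_near W I u v a b h : 0 < h ->
  exists2 e : R, 0 < e & `|coeff Phi (shear W a b e) I u + coeff Phi (shear W a b e) I v -
    (coeff Phi W I u + coeff Phi W I v)| < h.
Proof.
have near_para w J : (fun e : R => hpara Phi (shear W a b e) w (indic_row R J)) @ (0 : R) -->
    hpara Phi W w (indic_row R J).
  apply/cvgrPdist_lt => k k0.
  have [d d0 Pd] := supp_Phi_near valPhi contPhi w (body_para W (@nonneg_indic R n J)) k0.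
  pose q := edist (row b W) 0 + 1.
  have q0 : 0 < q by rewrite ltr_wpDl// euclidean_dist_ge0.
  near=> e.
  have edq : `|e| * q < d.
    rewrite -ltr_pdivlMr//; near: e.
    have dq : 0 < d / q by rewrite divr_gt0.
    by apply/nbhs_ballP; exists (d / q) => // e; rewrite /ball/= sub0r normrN.
  rewrite distrC; apply: (Pd _ (body_para _ (@nonneg_indic R n J)) (`|e| * q)) => //.
    by rewrite mulr_ge0// ltW.
  have close (x : V) : box 0 (indic_row R J) x ->
      edist (x *m W + 0) (x *m shear W a b e + 0) <= `|e| * q.
    move=> xb; rewrite !addr0 mul_shear mulmxDl -scalemxAl -rowE edist_shift normrM.
    rewrite -mulrA ler_wpM2l//.
    have := xb a; rewrite !mxE => /andP[x0 xJ].
    rewrite -[q]mul1r ler_pM// ?euclidean_dist_ge0// ?lerDl//.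
    by rewrite ger0_norm// (le_trans xJ)//; case: (a \in J).
  by split=> _ [x xb <-]; [exists (x *m shear W a b e + 0)|exists (x *m W + 0)];
    try exact: close; exists x.
have cvg_coeff w : (fun e : R => coeff Phi (shear W a b e) I w) @ (0 : R) --> coeff Phi W I w.
  by apply: cvg_sum_fun => J; apply: cvgM; [exact: cvg_cst|exact: near_para].
move=> h0; have := cvgD (cvg_coeff u) (cvg_coeff v).
move=> /(_ _)/cvgrPdist_lt /(_ h h0) /nbhs_ballP[r /= r0 rP].
exists (r / 2); first by rewrite divr_gt0.
rewrite distrC; apply: rP; rewrite /ball/= sub0r normrN gtr0_norm ?divr_gt0//.
by rewrite ltr_pdivrMr// ltr_pMr// ltr1n.
Unshelve. all: by end_near.
Qed.

(* The basis with w_b replaced by w_a + e w_b. *)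
Definition swap_shear W (a b : 'I_n) (e : R) : 'M[R]_n :=
  W + (delta_mx b a + (e - 1) *: delta_mx b b) *m W.

Lemma mul_swap_shear W a b e (x : V) : x *m swap_shear W a b e =
  (x + x 0 b *: delta_mx 0 a + ((e - 1) * x 0 b) *: delta_mx 0 b) *m W.
Proof.
rewrite mulmxDr mulmxA mulmxDr -scalemxAr !mul_row_delta scalerA -mulmxDl.
by rewrite addrA.
Qed.

Lemma swap_shear_unit W a b e : a != b -> e != 0 -> W \in unitmx ->
  swap_shear W a b e \in unitmx.
Proof.
move=> ab e0 Wu; rewrite -row_free_unit; apply: inj_row_free => x.
rewrite mul_swap_shear => /(congr1 (mulmx^~ (invmx W))); rewrite mulmxK// mul0mx => g0.
have xb : x 0 b = 0.
  have := congr1 (fun y : V => y 0 b) g0; rewrite !mxE eqxx [b == a]eq_sym (negbTE ab)/=.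
  rewrite eqxx mulr0 addr0 mulr1 => h.
  have /eqP : e * x 0 b = 0 by rewrite -h; ring.
  by rewrite mulf_eq0 (negbTE e0)/= => /eqP.
by move: g0; rewrite xb mulr0 !scale0r !addr0.
Qed.

(** Only the edges w_i with i in I enter the coefficient, and these are unchanged. *)
Lemma coeff_swap_shear_id W a b e I u : b \notin I ->
  coeff Phi (swap_shear W a b e) I u = coeff Phi W I u.
Proof.
move=> bI; apply: eq_bigr => J JI; congr (_ * supp (Phi _) _).
have bJ : b \notin J by apply: contra bI; exact: (fintype.subsetP JI).
have E (x : V) : box 0 (indic_row R J) x -> x *m swap_shear W a b e = x *m W.
  move=> /(_ b); rewrite !mxE (negbTE bJ) => /le_anti xb.
  by rewrite mul_swap_shear -xb mulr0 !scale0r !addr0.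
by apply/seteqP; split=> _ [x xb <-]; exists x => //; rewrite E.
Qed.

(** The edge w_a + e w_b sits at index a in [shear] and at index b in [swap_shear]. As b is not in
    I, both coefficients come from the same parallelepipeds. *)
Lemma coeff_swap_shear_perm W a b e I u : a != b -> b \notin I ->
  coeff Phi (swap_shear W a b e) (tperm a b @: I)%SET u = coeff Phi (shear W a b e) I u.
Proof.
move=> ab bI; apply/esym/mobius_perm => J JI; congr (supp (Phi _) _).
have bJ : b \notin J by apply: contra bI; exact: (fintype.subsetP JI).
have injt := @perm_inj _ (tperm a b).
pose sw (x : V) : V := \row_k x 0 (tperm a b k).
have swK x : sw (sw x) = x by apply/rowP => k; rewrite !mxE tpermK.
have indE k : indic_row R (tperm a b @: J)%SET 0 k = indic_row R J 0 (tperm a b k).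
  by rewrite !mxE -[k in LHS](tpermK a b) mem_imset.
have E (x : V) : box 0 (indic_row R J) x ->
    sw x *m swap_shear W a b e = x *m shear W a b e.
  move=> /(_ b); rewrite !mxE (negbTE bJ) => /le_anti xb.
  rewrite mul_swap_shear mul_shear; congr (_ *m _); apply/rowP => k.
  rewrite !mxE tpermR /=; case: tpermP => [->|->|/eqP ka /eqP kb].
  - by rewrite eqxx (negbTE ab) -xb /=; ring.
  - by rewrite eqxx [b == a]eq_sym (negbTE ab) -xb /=; ring.
  - by rewrite (negbTE ka) (negbTE kb) /=; ring.
have swbox x : box 0 (indic_row R (tperm a b @: J)%SET) (sw x) <-> box 0 (indic_row R J) x.
  split=> xb k.
    by have := xb (tperm a b k); rewrite indE !tpermK [sw x _ _]mxE tpermK !mxE.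
  by have := xb (tperm a b k); rewrite indE [sw x _ _]mxE !mxE.
apply/seteqP; split=> _ [x xb <-].
  by exists (sw x); [exact/swbox|rewrite E].
have xb' : box 0 (indic_row R J) (sw x) by apply/swbox; rewrite swK.
by exists (sw x) => //; rewrite -E// swK.
Qed.

End Shear.

(** * Linear algebra *)

Section LinearAlgebra.
Variables (R : realType) (n : nat).
Notation V := 'rV[R]_n.

(** The map [w - projv U w] kills U but not v; u represents a coordinate of it that is nonzero at
    v. *)
Lemma orthogonal_vspace (U : {vspace V}) (v : V) : v \notin U ->
  exists u, (forall w, w \in U -> dot w u = 0) /\ dot v u != 0.
Proof.
move=> vU; pose f (w : V) := w - projv U w.
have fU w : w \in U -> f w = 0 by move=> wU; rewrite /f projv_id// subrr.
have [i fi] : exists i, f v 0 i != 0.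
  apply/existsP; apply: contraNT vU; rewrite negb_exists => /forallP f0.
  have -> : v = projv U v.
    apply/eqP; rewrite -subr_eq0; apply/eqP/rowP => i; rewrite [RHS]mxE.
    by apply/eqP/negPn/f0.
  exact: memv_proj.
pose u : V := \row_k f (delta_mx 0 k) 0 i.
have dotE w : dot w u = f w 0 i.
  rewrite {2}(row_sum_delta w) /f linear_sum/= -sumrB summxE.
  by apply: eq_bigr => k _; rewrite linearZ/= -scalerBr !mxE.
by exists u; split=> [w /fU|]; rewrite dotE// => ->; rewrite mxE.
Qed.

Lemma size_free_le (X : seq V) : free X -> (size X <= n)%N.
Proof.
move=> /eqP <-; apply: leq_trans (dimvS (subvf _)) _.
by rewrite dimvf dim_matrix; exact/eq_leq/mul1n.
Qed.

Lemma span_proper (X : seq V) : (size X < n)%N -> exists v, v \notin <<X>>%VS.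
Proof.
move=> Xn; apply: contrapT => noV.
have full : (fullv <= <<X>>)%VS.
  by apply/subvP => v _; apply: contrapT => /negP vX; apply: noV; exists v.
have := leq_trans (dimvS full) (dim_span X).
rewrite dimvf dim_matrix => le1.
by have := leq_trans Xn (leq_trans (eq_leq (esym (mul1n n))) le1); rewrite ltnn.
Qed.

Definition rows_of (X : seq V) : 'M[R]_(size X, n) := \matrix_(i < size X) X`_i.

Lemma free_rows (X : seq V) : free X -> \rank (rows_of X) = size X.
Proof.
move=> fX; apply/eqP; apply: inj_row_free => v vX.
have /freeP := (fX : free (in_tuple X)); move=> /(_ (fun i => v 0 i)) v0.
apply/rowP => i; rewrite mxE; apply: v0.
transitivity (v *m rows_of X); last exact: vX.
by rewrite mulmx_sum_row; apply: eq_bigr => j _; rewrite rowK.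
Qed.

Lemma rank_rows_in_span (X : seq V) m (M : 'M[R]_(m, n)) :
  (forall i, row i M \in <<X>>%VS) -> (\rank M <= size X)%N.
Proof.
move=> MX; pose A := \matrix_(i < m, j < size X) coord (in_tuple X) j (row i M).
suff -> : M = A *m rows_of X by exact: mulmx_max_rank.
apply/row_matrixP => i; rewrite row_mul mulmx_sum_row.
rewrite {1}(coord_span (X := in_tuple X) (MX i)); apply: eq_bigr => j _.
by rewrite !mxE rowK.
Qed.

(** Adjoin differences outside the current span; freeness bounds their number by n. *)
Lemma exists_frame (K : set V) (x0 : V) : exists X : seq V,
  [/\ free X, forall v, v \in X -> K (v + x0) & forall x, K x -> x - x0 \in <<X>>%VS].
Proof.
suff ext k (X : seq V) : (n - size X < k)%N -> free X -> (forall v, v \in X -> K (v + x0)) ->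
    exists X : seq V, [/\ free X, forall v, v \in X -> K (v + x0) &
      forall x, K x -> x - x0 \in <<X>>%VS].
  by apply: (ext (n.+1) [::]); rewrite ?subn0 ?nil_free.
elim: k X => // k IH X Xk fX KX.
have [spans|] := pselect (forall x, K x -> x - x0 \in <<X>>%VS); first by exists X.
move=> /existsNP[x /not_implyP[Kx /negP xX]].
have fX' : free ((x - x0) :: X) by rewrite free_cons xX.
apply: (IH _ _ fX') => [|v]; first by have := size_free_le fX'; rewrite /=; lia.
by rewrite inE => /orP[/eqP ->|/KX//]; rewrite subrK.
Qed.

Lemma has_dim_frame (K : set V) (x0 : V) (X : seq V) : K x0 -> free X ->
  (forall v, v \in X -> K (v + x0)) -> (forall x, K x -> x - x0 \in <<X>>%VS) ->
  has_dim K (size X).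
Proof.
move=> Kx0 fX KX spanX; exists x0 => //; split.
  exists (rows_of X); last exact: free_rows.
  by move=> i; rewrite rowK; apply: KX; rewrite mem_nth.
move=> m M MK; apply: rank_rows_in_span => i.
by have := spanX _ (MK i); rewrite addrK.
Qed.

End LinearAlgebra.

(** * The dimension of the image of a point *)

Section Dimension.
Variables (R : realType) (n : nat) (Phi : set 'rV[R]_n -> set 'rV[R]_n).
Notation V := 'rV[R]_n.
Notation tagged := ({set 'I_n} * V)%type.
Implicit Types (u v : V) (W : 'M[R]_n) (I J : {set 'I_n}) (s : seq tagged).

Hypotheses (valPhi : minkowski_valuation Phi) (contPhi : hcontinuous Phi)
  (invPhi : translation_invariant Phi) (n0 : (0 < n)%N) (vcPhi : VC Phi).

(** Each vector keeps the set I whose body it comes from, since balancedness concerns these sets. *)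
Definition valid W s : Prop := forall q, q \in s -> coeff_diff Phi W q.1 q.2.
Notation vecs s := (map snd s : seq V).

Lemma valid_cons W q s : coeff_diff Phi W q.1 q.2 -> valid W s -> valid W (q :: s).
Proof. by move=> qD sD r; rewrite inE => /orP[/eqP ->|/sD]. Qed.

(** While the span is proper, take u orthogonal to it; by [coeff_diff_span] some difference is not
    orthogonal to u and enlarges the free family. *)
Lemma extend_valid W s : W \in unitmx -> valid W s -> free (vecs s) ->
  exists s', [/\ valid W (s' ++ s), free (vecs (s' ++ s)) & size (s' ++ s) = n].
Proof.
move=> Wu; have [k] := ubnP (n - size s); elim: k s => // k IH s sk vs fs.
have := size_free_le fs; rewrite size_map leq_eqVlt => /orP[/eqP sn|sn].
  by exists [::].
have [v0 v0s] : exists v, v \notin <<vecs s>>%VS by apply: span_proper; rewrite size_map.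
have [u [us v0u]] := orthogonal_vspace v0s.
have u0 : u != 0.
  apply: contraNneq v0u => ->; rewrite dotC -(subrr 0) dotBl subrr.
  by [].
have [I [v [Iv vu]]] := coeff_diff_span valPhi contPhi invPhi n0 vcPhi Wu u0.
have [|||s' [vs' fs' ns']] := IH ((I, v) :: s).
- by move: sn sk; rewrite /=; clear; lia.
- exact: valid_cons.
- by rewrite /= free_cons fs andbT; apply: contra vu => /us ->.
by exists (rcons s' (I, v)); rewrite cat_rcons.
Qed.

Lemma valid_balanced W s : W \in unitmx -> valid W s -> free (vecs s) -> size s = n ->
  forall m, count (fun q : tagged => m \in q.1) s = 1%N.
Proof.
move=> Wu vs fs sn m.
pose q (i : nat) : tagged := nth (finset.set0, 0) s i.
pose T : 'M[R]_n := \matrix_(i < n) (q i).2.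
have qT i : (i < n)%N -> (q i).2 = (vecs s)`_i.
  by move=> i_n; rewrite (nth_map (finset.set0, 0)) ?sn.
have Tu : T \in unitmx.
  rewrite -row_free_unit; apply: inj_row_free => x xT.
  have sz : size (vecs s) == n by rewrite size_map sn.
  have /freeP := (fs : free (Tuple sz)); move=> /(_ (fun i => x 0 i)) x0.
  apply/rowP => i; rewrite mxE; apply: x0.
  transitivity (x *m T); last exact: xT.
  by rewrite mulmx_sum_row; apply: eq_bigr => j _; rewrite rowK qT.
have DI (i : 'I_n) : coeff_diff Phi W (q i).1 (row i T).
  by rewrite rowK; apply: vs; rewrite mem_nth// sn.
apply: etrans (coeff_diff_balanced valPhi contPhi invPhi n0 vcPhi Wu Tu DI m).
by rewrite -sum1_count (big_nth (finset.set0, 0)) sn big_mkord sum1dep_card.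
Qed.

(** The parallelepiped of the empty set is the origin, and translation invariance replaces it by
    p. *)
Lemma coeff_set0 W p u : coeff Phi W finset.set0 u = supp (Phi [set p]) u.
Proof.
rewrite /coeff /mobius (big_pred1 finset.set0) => [|J]; last by rewrite finset.subset0.
rewrite finset.setD0 cards0 expr0 mul1r /hpara.
have -> : para W (indic_row R finset.set0) = [set 0].
  apply/seteqP; split=> [_ [x xb <-]|_ ->].
    have -> : x = 0 by apply/rowP => i; have := xb i; rewrite !mxE inE => /le_anti.
    by rewrite mul0mx addr0.
  by exists 0; [move=> i; rewrite !mxE inE lexx|rewrite mul0mx addr0].
rewrite -(invPhi p (body_set1 0)); congr (supp (Phi _) u).
apply/seteqP; split=> [_ [_ -> <-]|_ ->]; first by rewrite /= add0r.
by exists 0 => //; rewrite add0r.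
Qed.

Lemma coeff_body_set0 W p x : coeff_body Phi W finset.set0 x <-> Phi [set p] x.
Proof.
have bK : convex_body (Phi [set p]) by apply: valPhi.1; exact: body_set1.
split=> [xK|xK u]; last by rewrite (coeff_set0 W p); exact: dot_le_supp.
by apply: mem_body => // u; rewrite -(coeff_set0 W p).
Qed.

(* Complete a basis X of differences of Phi {p} by a difference for I. A difference for J can
   either be added, so that c is covered twice, or exchanged with the one for I, so that
   a is covered once more by one family than by the other. *)
Lemma overlapping_widths W (X : seq V) I J (u : V) (a c : 'I_n) : W \in unitmx ->
  free X -> (forall v, v \in X -> coeff_diff Phi W finset.set0 v) ->
  (forall v, v \in X -> dot v u = 0) ->
  (forall v, coeff_diff Phi W finset.set0 v -> v \in <<X>>%VS) ->
  a \in I -> a \notin J -> c \in I -> c \in J ->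
  0 < coeff Phi W I u + coeff Phi W I (- u) ->
  0 < coeff Phi W J u + coeff Phi W J (- u) -> False.
Proof.
move=> Wu fX DX Xu spanX aI aJ cI cJ wI wJ.
pose s0 : seq tagged := [seq (finset.set0, v) | v <- X].
have vs0 : vecs s0 = X by rewrite -map_comp map_id.
have val0 : valid W s0 by move=> _ /mapP[v vX ->]; exact: DX.
have orthX v : v \in <<X>>%VS -> dot v u = 0.
  move=> /(coord_span (X := in_tuple X)) ->; rewrite dot_suml big1// => i _.
  by rewrite dotZl Xu ?mulr0// mem_nth.
have [v Iv vu] := coeff_diff_exists valPhi contPhi invPhi I u Wu.
have [v' Jv' vu'] := coeff_diff_exists valPhi contPhi invPhi J u Wu.
rewrite -vu in wI; rewrite -vu' in wJ.
have vX : v \notin <<X>>%VS by apply: contraTN wI => /orthX ->; rewrite ltxx.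
have vX' : v' \notin <<X>>%VS by apply: contraTN wJ => /orthX ->; rewrite ltxx.
have val1 : valid W ((I, v) :: s0) by exact: valid_cons.
have free1 : free (vecs ((I, v) :: s0)) by rewrite /= vs0 free_cons vX.
(* An independent v' would give a family in which both I and J contain c. *)
have [vv'|vv'] := boolP (v' \in <<v :: X>>%VS); last first.
  have [||s' [val' free' size']] := @extend_valid W ((J, v') :: (I, v) :: s0) Wu.
  - exact: valid_cons.
  - by rewrite /= vs0 free_cons vv' free_cons vX.
  have := valid_balanced Wu val' free' size' c.
  by rewrite count_cat /= cI cJ !add1n !addnS.
have [s' [val' free' size']] := extend_valid Wu val1 free1.
pose Y := s' ++ s0.
have perm' : perm_eq (s' ++ (I, v) :: s0) ((I, v) :: Y) by rewrite perm_catC/= perm_cons perm_catC.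
have freeY : free (vecs ((I, v) :: Y)) by rewrite -(perm_free (perm_map snd perm')).
have valY : valid W ((I, v) :: Y) by move=> q qY; apply: val'; rewrite (perm_mem perm').
have XY w : w \in <<X>>%VS -> w \in <<vecs Y>>%VS.
  apply/subvP: w; apply: sub_span => w wX.
  by rewrite map_cat mem_cat vs0 wX orbT.
move: (freeY); rewrite /= free_cons => /andP[vY fY].
(* Write v' = k v + e with e in the span of X. Here k is nonzero, so v' in the span of Y would put v
   there too. *)
have v'Y : v' \notin <<vecs Y>>%VS.
  apply/negP => v'Y; move: vv'; rewrite span_cons => /memv_addP[_ /vlineP[k ->] [e eX v'E]].
  have [k0|k0] := eqVneq k 0.
    by move: vX'; rewrite v'E k0 scale0r add0r eX.
  move/negP: vY; apply; have -> : v = k^-1 *: (v' - e) by rewrite v'E addrK scalerA mulVf ?scale1r.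
  by apply/memvZ/memvB => //; exact: XY.
have valY' : valid W ((J, v') :: Y).
  by apply: valid_cons => // q qY; apply: valY; rewrite inE qY orbT.
have freeY' : free (vecs ((J, v') :: Y)) by rewrite /= free_cons v'Y.
have sizeY : size ((I, v) :: Y) = n := etrans (esym (perm_size perm')) size'.
(* By the first family Y never covers a; by the second it covers a once. *)
have c1 := valid_balanced Wu valY freeY sizeY a.
have c2 := valid_balanced Wu valY' freeY' sizeY a.
by move: c1 c2; rewrite /= aI (negbTE aJ) add1n add0n => -[->].
Qed.

Lemma frame_size_extremal (p x0 : V) (X : seq V) : Phi [set p] x0 -> free X ->
  (forall v, v \in X -> Phi [set p] (v + x0)) ->
  (forall x, Phi [set p] x -> x - x0 \in <<X>>%VS) ->
  size X = 0%N \/ size X = n.-1.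
Proof.
move=> Kx0 fX KX spanX.
have D0 W v : v \in X -> coeff_diff Phi W finset.set0 v.
  move=> vX; exists x0, (v + x0); split; [exact/(coeff_body_set0 W p)| |by rewrite addrK].
  by apply/(coeff_body_set0 W p); exact: KX.
have span0 W v : coeff_diff Phi W finset.set0 v -> v \in <<X>>%VS.
  move=> [x [y [/(coeff_body_set0 W p) xK /(coeff_body_set0 W p) yK ->]]].
  have -> : y - x = (y - x0) - (x - x0) by rewrite opprB addrA subrK.
  by apply: memvB; exact: spanX.
apply: contrapT => /not_orP[sX0 sXn].
pose s0 : seq tagged := [seq (finset.set0, v) | v <- X].
have vs0 : vecs s0 = X by rewrite -map_comp map_id.
have u1 : (1%:M : 'M[R]_n) \in unitmx by exact: unitmx1.
have val0 : valid 1%:M s0 by move=> _ /mapP[v vX ->]; exact: D0.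
have free0 : free (vecs s0) by rewrite vs0.
have count0 m : count (fun q : tagged => m \in q.1) s0 = 0%N.
  apply/eqP; rewrite -leqn0 leqNgt -has_count -all_predC.
  by apply/allP => _ /mapP[v _ ->] /=; rewrite inE.
(* The members of [s0] carry the empty set and cover no index, so the added members alone partition
   the index set. *)
have [s1 [val1 free1 size1]] := extend_valid u1 val0 free0.
have bal m : count (fun q : tagged => m \in q.1) s1 = 1%N.
  by have := valid_balanced u1 val1 free1 size1 m; rewrite count_cat count0 addn0.
have ss1 : (size s1 + size X = n)%N by have := size1; rewrite size_cat size_map.
have s1_gt0 : (0 < size s1)%N.
  by have := bal (Ordinal n0); case: (s1).
(* A single added vector would mean that X has n - 1 elements, which is excluded. *)
have s1_ge2 : (1 < size s1)%N by move: ss1 sX0 sXn s1_gt0; clear; lia.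
have s1_lt : (size s1 < n)%N by move: ss1 sX0; clear; lia.
have not_span q : q \in s1 -> q.2 \notin <<X>>%VS.
  move=> qs1; move: free1; rewrite map_cat vs0.
  have /perm_free -> : perm_eq (vecs s1 ++ X) (q.2 :: (vecs (rem q s1) ++ X)).
    by rewrite -cat_cons perm_cat2r; apply: (perm_map snd (perm_to_rem qs1)).
  rewrite free_cons => /andP[+ _]; apply: contra.
  apply/subvP/sub_span => w wX; by rewrite mem_cat wX orbT.
(* A vector tagged by the empty set would lie in the span of X. *)
have nonempty q : q \in s1 -> (0 < #|q.1|)%N.
  move=> qs1; rewrite lt0n cards_eq0; apply: contra (not_span _ qs1) => /eqP q0.
  by apply: (span0 1%:M); rewrite -q0; apply: val1; rewrite mem_cat qs1.
have card_sum : (\sum_(q <- s1) #|q.1| = n)%N.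
  rewrite -[RHS]card_ord -sum1_card.
  under eq_bigr do rewrite -sum1_card big_mkcond/=.
  rewrite exchange_big/=; apply: eq_bigr => m _.
  by rewrite -big_mkcond/= sum1_count; exact: bal.
(* The n indices are shared among fewer than n blocks. *)
have [q qs1 q2] : exists2 q, q \in s1 & (1 < #|q.1|)%N.
  apply: contrapT => none.
  have le1 : (\sum_(q <- s1) #|q.1| <= size s1)%N.
    rewrite -sum1_size big_seq [leqRHS]big_seq leq_sum// => q qs1.
    by rewrite leqNgt; apply/negP => q2; apply: none; exists q.
  by move: s1_lt; rewrite ltnNge; move: le1; rewrite card_sum => ->.
have permq := perm_to_rem qs1.
(* Another block is nonempty and, by balancedness, disjoint from this one. *)
have [b bq] : exists b, b \notin q.1.
  have [q' q's] : exists q', q' \in rem q s1.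
    have := perm_size permq; rewrite /=; case: (rem q s1) => [|q' r] E.
      by rewrite E in s1_ge2.
    by exists q'; rewrite inE eqxx.
  have /card_gt0P[b bq'] := nonempty q' (mem_rem q's).
  exists b; apply/negP => bq; have := bal b.
  rewrite (seq.permP permq)/= bq add1n => -[] cnt0.
  suff : (0 < count (fun r : tagged => b \in r.1) (rem q s1))%N by rewrite cnt0.
  by rewrite -has_count; apply/hasP; exists q'.
(* The index a will be traded for b, whereas c stays in both index sets. *)
have /card_gt1P[a [c [aq cq ac]]] := q2.
have ab : a != b by apply: contraNneq bq => <-.
have cb : c != b by apply: contraNneq bq => <-.
have [u [Xu qu]] := orthogonal_vspace (not_span q qs1).
have wq : 0 < coeff Phi 1%:M q.1 u + coeff Phi 1%:M q.1 (- u).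
  have := coeff_diff_width u (val1 q _); rewrite mem_cat qs1 => /(_ isT).
  by apply: lt_le_trans; rewrite normr_gt0.
(* The tolerance is the width along u itself, so the perturbed width remains positive. *)
have [e e0 eq] := coeff_shear_near valPhi contPhi 1%:M q.1 u (- u) a b wq.
pose W := swap_shear (1%:M : 'M[R]_n) a b e.
have Wu : W \in unitmx by apply: swap_shear_unit => //; rewrite gt_eqF.
apply: (@overlapping_widths W X q.1 (tperm a b @: q.1)%SET u a c) => //.
- exact: D0.
- by move=> v vX; apply: Xu; exact: memv_span.
- exact: span0.
- apply/negP => /imsetP[k kq /(congr1 (tperm a b))].
  by rewrite tpermL tpermK => kb; rewrite kb kq in bq.
- by apply/imsetP; exists c => //; rewrite tpermD// eq_sym.
- by rewrite !coeff_swap_shear_id.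
- rewrite !coeff_swap_shear_perm//.
  by move: eq; rewrite ltr_norml => /andP[+ _]; rewrite ltrBrDr addNr.
Qed.

End Dimension.

Theorem theorem3p1 (R : realType) (n : nat) (p : 'rV[R]_n)
  (Phi : set 'rV[R]_n -> set 'rV[R]_n) :
  (2 <= n)%N ->
  minkowski_valuation Phi -> hcontinuous Phi -> translation_invariant Phi ->
  VC Phi ->
  has_dim (Phi [set p]) 0 \/ has_dim (Phi [set p]) n.-1.
Proof.
move=> n2 valPhi contPhi invPhi vcPhi.
have [[x0 Kx0] _] : convex_body (Phi [set p]) by apply: valPhi.1; exact: body_set1.
(* The size of this frame of differences is the dimension of Phi {p}. *)
have [X [fX KX spanX]] := exists_frame (Phi [set p]) x0.
have dimX := has_dim_frame Kx0 fX KX spanX.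
have [E|E] := frame_size_extremal valPhi contPhi invPhi (ltnW n2) vcPhi Kx0 fX KX spanX.
  by left; move: dimX; rewrite E.
by right; move: dimX; rewrite E.
Qed.
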